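(* Let $R>0$, $M\ge0$, $\sigma>0$. Let $$\sigma_b^2:=\frac{4R}{\pi}\Big(M+\frac{R}{\sqrt3}+2\Big),\qquad c_b:=\frac{4R^2M}{\pi\sqrt3},$$ and let $\sigma_s>0$ be the unique positive solution of $$\sigma_s^2=\frac{4R(3+M)}{\pi}+\frac{4R^2}{\pi\sqrt3}\exp\Big(\frac{8R(1+M)}{\sigma_s^2}\Big).$$ Let $\rho_0\in H^3_{ep}(\tilde X)\cap\mathcal P_e(\tilde X)$ and $\rho_r\in H^2_{ep}(\tilde X)\cap\mathcal P_e(\tilde X)$, and let $\rho\in C^1(0,\infty;C^2_{ep}(\tilde X))$ with $\rho(t):=\rho(\cdot,t)\in\mathcal P_e(\tilde X)$ be the solution of $$\rho_t=(\rho\,G_\rho)_x+\tfrac{\sigma^2}{2}\rho_{xx}\ \text{ for } t>0,\qquad \rho(x+2,t)=\rho(x,t),\qquad \rho(\cdot,0)=\rho_0,$$ where $G_\rho=w\star(\rho+M\rho_r)$. For any $\eta>0$, if $\sigma^2>\max\{\sigma_b^2+\eta c_b,\ \sigma_s^2\}$, then for all $t\ge0$ $$\|\rho(t)-1\|_{L^2}\le\beta e^{-\lambda t}+\frac1\eta\|\rho_r\|_{L^2},$$ where the constant $\beta>0$ depends on $\rho_0$ and $\rho_r$ (but not on $t$) and the rate $\lambda>0$ depends only on $\sigma$, $R$ and $M$.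
   Context: $X=[0,1]$, $\tilde X=[-1,1]$. Functions on $\tilde X$ in the periodic spaces below are identified with their $2$-periodic extensions to $\mathbb R$. The function $w:\mathbb R\to\mathbb R$ is $w(\xi)=\xi$ if $|\xi|\le R$ and $w(\xi)=0$ if $|\xi|>R$, and $(w\star f)(x)=\int_{\mathbb R}w(x-y)f(y)\,dy=\int_{x-R}^{x+R}(x-y)f(y)\,dy$ for $2$-periodic $f$ (convolution in $x$). $\mathcal P_e(\tilde X)$ is the set of functions $\rho:\tilde X\to[0,\infty)$ with $\int_X\rho(x)\,dx=1$ and $\rho(-x)=\rho(x)$. $H^k=W^{k,2}$; $H^k_{per}(\tilde X)$ is the space of $2$-periodic functions in $H^k_{loc}(\mathbb R)$, and $H^k_{ep}(\tilde X)$ is its subspace of even functions. $C^2_{ep}(\tilde X)$ is the space of even, $2$-periodic, twice continuously differentiable functions on $\mathbb R$. $C^1(0,\infty;C^2_{ep}(\tilde X))$ denotes the continuously differentiable maps from $(0,\infty)$ to $C^2_{ep}(\tilde X)$. The PDE holds pointwise for $t>0$; the initial condition is understood in the sense that $t\mapsto\rho(\cdot,t)$ is continuous from $[0,\infty)$ to $L^2(\tilde X)$ with value $\rho_0$ at $t=0$. Under the stated hypotheses on $\rho_0,\rho_r$ such a solution exists and is unique. The $L^2$ norms are over $\tilde X$. The constant $\beta$ may also depend on the model parameters $R,M,\sigma$. *)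

(* Defs.v *)
From HB Require Import structures.
From mathcomp Require Import all_boot all_order all_algebra.
From mathcomp Require Import all_classical all_reals all_analysis.

Set Implicit Arguments.
Unset Strict Implicit.
Unset Printing Implicit Defensive.

Import Order.TTheory GRing.Theory Num.Theory.
Import numFieldNormedType.Exports.

Local Open Scope ring_scope.
Local Open Scope classical_set_scope.

(* Functions on [-1, 1] with periodic boundary conditions are represented by
   their 2-periodic extensions to the whole line.  Elements of Lebesgue and
   Sobolev spaces are represented by functions defined everywhere. *)

Section FunctionSpaces.
Context {R : realType}.
Notation mu := (@lebesgue_measure R).

Definition even_function (f : R -> R) := forall x, f (- x) = f x.

Definition test_function (phi : R -> R) :=
  (forall n x, derivable (derive1n n phi) x 1) /\
  compact (closure [set x | phi x != 0]).

Definition L2_loc (f : R -> R) :=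
  measurable_fun setT f /\ locally_integrable setT (fun x => f x ^+ 2).

Definition weak_derivative (n : nat) (f g : R -> R) :=
  forall phi, test_function phi ->
    \int[mu]_x (f x * derive1n n phi x) = (-1) ^+ n * \int[mu]_x (g x * phi x).

Definition H_loc (k : nat) (f : R -> R) :=
  L2_loc f /\
  forall n, (n <= k)%N -> exists2 g, L2_loc g & weak_derivative n f g.

Definition H_per (k : nat) (f : R -> R) := periodic f 2 /\ H_loc k f.

Definition H_ep (k : nat) (f : R -> R) := H_per k f /\ even_function f.

Definition C2_ep (f : R -> R) :=
  [/\ even_function f, periodic f 2,
      forall n x, (n < 2)%N -> derivable (derive1n n f) x 1 &
      continuous (derive1n 2 f)].

Definition C2_norm (f : R -> R) : R :=
  \sum_(n < 3) sup [set `|derive1n n f x| | x in `[-1, 1]].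

Definition P_e (f : R -> R) :=
  [/\ forall x, -1 <= x <= 1 -> 0 <= f x,
      forall x, -1 <= x <= 1 -> f (- x) = f x &
      (\int[mu]_(x in `[0%R, 1%R]) (f x)%:E = 1)%E].

Definition L2norm (f : R -> R) : \bar R :=
  ('N[mu]_2%:E[EFin \o (f \_ `[(-1)%R, 1%R])])%E.

(* rho t x is the value at time t and position x; only the restriction of rho
   to 0 < t matters here. *)
Definition C1_C2_ep (rho : R -> R -> R) :=
  exists rho' : R -> R -> R, forall t, 0 < t ->
    [/\ C2_ep (rho t), C2_ep (rho' t),
        C2_norm (fun x => h^-1 * (rho (t + h) x - rho t x) - rho' t x)
          @[h --> 0^'] --> 0 &
        C2_norm (fun x => rho' s x - rho' t x) @[s --> t] --> 0].

Definition continuous_L2 (rho : R -> R -> R) :=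
  forall t, 0 <= t ->
    L2norm (fun x => rho s x - rho t x)
      @[s --> within [set s | 0 <= s] (nbhs t)] --> 0%E.

End FunctionSpaces.

Section Model.
Context {R : realType}.
Variables r M sigma : R.
Notation mu := (@lebesgue_measure R).

Definition w (xi : R) : R := if `|xi| <= r then xi else 0.

Definition w_conv (f : R -> R) (x : R) : R :=
  \int[mu]_y (w (x - y) * f y).

Definition G (rho_r f : R -> R) : R -> R :=
  w_conv (fun y => f y + M * rho_r y).

(* Every derivative below exists in the classical sense (by C1_C2_ep, and
   because w_conv of a function that is a.e. equal to a continuous one is C^1),
   so the PDE never uses the default value of derive1. *)
Definition solution (rho0 rho_r : R -> R) (rho : R -> R -> R) :=
  [/\ C1_C2_ep rho,
      forall t, 0 <= t -> P_e (rho t),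
      forall t x, 0 < t ->
        derive1 (fun s => rho s x) t =
          derive1 (fun y => rho t y * G rho_r (rho t) y) x
          + sigma ^+ 2 / 2 * derive1n 2 (rho t) x,
      continuous_L2 rho &
      rho 0 = rho0].

Definition sigma_b2 : R := 4 * r / pi * (M + r / Num.sqrt 3 + 2).

Definition c_b : R := 4 * r ^+ 2 * M / (pi * Num.sqrt 3).

Definition sigma_s_equation (s : R) :=
  s ^+ 2 = 4 * r * (3 + M) / pi
           + 4 * r ^+ 2 / (pi * Num.sqrt 3)
             * expR (8 * r * (1 + M) / s ^+ 2).

End Model.

(* Main.v *)
Require Import Defs.
From HB Require Import structures.
From mathcomp Require Import all_boot all_order all_algebra.
From mathcomp Require Import all_classical all_reals all_analysis.
From mathcomp Require Import measurable_realfun.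
From mathcomp Require Import ring lra.

Import Order.TTheory GRing.Theory Num.Theory.
Import numFieldNormedType.Exports.

Local Open Scope ring_scope.
Local Open Scope classical_set_scope.

(** The energy method.  Let psi = rho - 1, which has mean zero, and write y, z, m
    for the norms of psi, psi_x and rho_r in L^2(-1, 1).  The kernel w is odd, so
    convolution with it kills constants and G = w * psi + M (w * rho_r).  Multiply
    the equation by psi and integrate over a period:
      (1/2) (y^2)' = - (sigma^2/2) z^2 - int psi G psi_x - int G psi_x.
    The two interaction terms are controlled by
      - the pointwise bound |G| <= 2 r (1 + M), valid for densities of
        mass 2 per period (w_conv_bound);
      - the L^2 bound |w * g| <= (2 r^2 / sqrt 3) |g| (w_conv_L2).
    Hence, with K = 2 r (1 + M) + 2 r^2 / sqrt 3 and C = 2 r^2 M / sqrt 3,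
      (1/2) (y^2)' <= z (- (sigma^2/2) z + K y + C m)        (energy_estimate).
    The Wirtinger inequality pi y <= z (wirtinger) lets diffusion absorb K y as
    soon as kappa = pi sigma^2/2 - K is positive.  Put mu = m / eta.  The assumption
    on sigma says that kappa > 0 and C m <= kappa mu (coercivity_gt0), and Young's
    inequality turns the estimate into (y^2)' <= kappa pi (mu^2 - y^2)
    (dissipation).  By Gronwall, for 0 < s <= t,
      y(t)^2 <= mu^2 + y(s)^2 e^(- kappa pi (t - s)),
    and L^2 continuity at time 0 bounds y(s) for small s by the initial datum.
    Taking square roots gives the rate lambda = kappa pi / 2.

    The integration by parts of the flux rho G needs care, because rho_r is a
    function defined up to null sets: G is then an indefinite Lebesgue integral
    rather than visibly C^1.  The predicate primitive records this, primitiveM is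
    the product rule for such functions, and the equation itself identifies the
    density of rho G with a continuous function (flux_primitive). *)

Set Implicit Arguments.
Unset Strict Implicit.

(** * Indefinite Lebesgue integrals *)

Section Primitives.
Context {R : realType}.
Notation mu := (@lebesgue_measure R).
Implicit Types (f g F : R -> R) (a b c x y : R).

(** Multiplying the difference quotient by |h| avoids division: this form is what
    estimates of increments deliver directly. *)
Lemma is_derive_of_estimate f x d :
  (forall e, 0 < e -> \forall h \near (0 : R),
     `|f (x + h) - f x - d * h| <= e * `|h|) ->
  is_derive x (1 : R) f d.
Proof.
move=> fx.
have fd : h^-1 *: ((f \o shift x) h%:A - f x) @[h --> 0^'] --> d.
  apply/cvgrPdist_le => e e0.
  have /= fxe := fx _ e0.
  near=> h.
  have h0 : h != 0 by near: h; exact: nbhs_dnbhs_neq.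
  have He : `|f (x + h) - f x - d * h| <= e * `|h|.
    by near: h; exact: nbhs_dnbhs fxe.
  rewrite /= [h%:A]mulr1 [h + x]addrC -(ler_pM2r (x := `|h|)) ?normr_gt0//.
  rewrite -normrM; apply: le_trans He.
  rewrite -normrN le_eqVlt; apply/orP; left; apply/eqP; congr `|_|.
  rewrite -[_ *: _]/(_ * _); field.
  exact: h0.
have F1 : 'D_1 f x = d by apply: cvg_lim.
by rewrite -F1 in fd *; constructor.
Unshelve. all: by end_near. Qed.

Lemma continuous_within_itv {f a b} : continuous f -> {within `[a, b], continuous f}.
Proof. by move=> cf; exact: continuous_subspaceT. Qed.

Lemma continuous_integrable_itv f a b : continuous f ->
  mu.-integrable `[a, b] (EFin \o f).
Proof.
move=> cf; apply: continuous_compact_integrable; first exact: segment_compact.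
exact: continuous_within_itv.
Qed.

Lemma locally_integrable_itv f a b : locally_integrable setT f ->
  mu.-integrable `[a, b] (EFin \o f).
Proof.
move=> [mf _ Kf]; apply/integrableP; split.
  by apply/measurable_EFinP; exact: measurable_funTS.
by apply: Kf => //; exact: segment_compact.
Qed.

(** Every compact set lies in some interval [-n, n]. *)
Lemma locally_integrable_of_itv f : measurable_fun setT f ->
  (forall n : nat, mu.-integrable `[- n%:R, n%:R] (EFin \o f)) ->
  locally_integrable setT f.
Proof.
move=> mf fi; split => //; first exact: openT.
move=> K _ cK.
have [M [_ MK]] := compact_bounded cK.
pose n := (Num.truncn (`|M| + 1)).+1.
have Kn : K `<=` `[- n%:R, n%:R].
  move=> x /= Kx.
  have xn : `|x| <= n%:R.
    apply: (le_trans (MK (`|M| + 1) _ x Kx)).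
      by rewrite (le_lt_trans (ler_norm M))// ltrDl.
    by rewrite ltW// truncnS_gt// addr_ge0.
  by rewrite in_itv/= -ler_norml.
have mK : measurable K by exact: compact_measurable.
have /integrableP[_] : mu.-integrable K (EFin \o f).
  by apply: (@integrableS _ _ _ mu `[- n%:R, n%:R] K).
by [].
Qed.

Lemma continuous_locally_integrable f : continuous f -> locally_integrable setT f.
Proof.
move=> cf; apply: locally_integrable_of_itv; first exact: continuous_measurable_fun.
by move=> n; exact: continuous_integrable_itv.
Qed.

(** A continuous factor is bounded on each compact interval. *)
Lemma locally_integrableMr f g : continuous g -> locally_integrable setT f ->
  locally_integrable setT (fun x => f x * g x).
Proof.
move=> cg lf; have mf : measurable_fun setT f by case: lf.
have mg : measurable_fun setT g by exact: continuous_measurable_fun.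
apply: locally_integrable_of_itv; first exact: measurable_funM.
move=> n; have nn : - n%:R <= n%:R :> R by rewrite lerNl -subr_ge0 opprK addr_ge0.
have /(EVT_max nn)[c _ cM] : {within `[- n%:R, n%:R], continuous (fun x => `|g x|)}.
  by apply: continuous_within_itv => x; apply: cvg_norm; exact: cg.
apply: (@le_integrable _ _ _ mu _ _ _ (EFin \o (fun x => `|g c| * f x))) => //.
- by apply/measurable_EFinP; apply: measurable_funTS; exact: measurable_funM.
- move=> x xn /=; rewrite lee_fin !normrM normr_id mulrC ler_wpM2r//.
  exact: cM.
- rewrite (_ : _ \o _ = (fun x => (`|g c|)%:E * (EFin \o f) x)%E)//.
  by apply: integrableZl => //; exact: locally_integrable_itv.
Qed.

Lemma locally_integrable_norm f : locally_integrable setT f ->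
  locally_integrable setT (fun x => `|f x|).
Proof.
move=> lf; have mf : measurable_fun setT f by case: lf.
apply: locally_integrable_of_itv; first exact: measurableT_comp.
by move=> n; have /integrable_abse := locally_integrable_itv (- n%:R) n%:R lf.
Qed.

Lemma locally_integrableZ f c : locally_integrable setT f ->
  locally_integrable setT (fun x => c * f x).
Proof.
move=> lf; rewrite (_ : (fun x => c * f x) = (fun x => f x * cst c x)).
  by apply: locally_integrableMr => //; exact: cst_continuous.
by apply/funext => x; rewrite mulrC.
Qed.

Lemma Rintegral_chasles f a b c : a <= b -> b <= c ->
  locally_integrable setT f ->
  \int[mu]_(x in `[a, c]) f x =
  \int[mu]_(x in `[a, b]) f x + \int[mu]_(x in `[b, c]) f x.
Proof.
move=> ab bc lf.
rewrite -(subrK (\int[mu]_(x in `[a, b]) f x) (\int[mu]_(x in `[a, c]) f x)).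
rewrite addrC; congr (_ + _).
rewrite Rintegral_itvB ?bnd_simp//; last exact: locally_integrable_itv.
rewrite Rintegral_itv_obnd_cbnd//.
have : mu.-integrable `[b, c] (EFin \o f) by exact: locally_integrable_itv.
by apply: integrableS => //; apply: subset_itvr; rewrite bnd_simp.
Qed.

(** Absolutely continuous functions, encoded as indefinite integrals: F is
    determined by f up to an additive constant, and f by F up to null sets.  This
    is the regularity that the drift G has when the reference density is only
    known almost everywhere. *)
Definition primitive f F := locally_integrable setT f /\
  forall a b, a <= b -> \int[mu]_(x in `[a, b]) f x = F b - F a.

Lemma Rintegral_seg1 f a : \int[mu]_(x in `[a, a]) f x = 0.
Proof. by rewrite set_itv1 Rintegral_set1. Qed.

(** The oriented integral from 0 serves as the primitive. *)
Lemma primitive_exists f : locally_integrable setT f -> exists F, primitive f F.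
Proof.
move=> lf.
exists (fun x => \int[mu]_(y in `[0, x]) f y - \int[mu]_(y in `[x, 0]) f y).
split => // a b ab.
have E0 u v : v < u -> \int[mu]_(y in `[u, v]) f y = 0.
  by move=> vu; rewrite set_itv_ge ?Rintegral_set0// bnd_simp -ltNge.
have [a0|a0] := leP 0 a.
  have b0 := le_trans a0 ab.
  rewrite (Rintegral_chasles a0 ab lf).
  have Z c : 0 <= c -> \int[mu]_(y in `[c, 0]) f y = 0.
    by rewrite le_eqVlt => /predU1P[<-|/E0//]; rewrite Rintegral_seg1.
  by rewrite !Z//; lra.
have [b0|b0] := leP 0 b.
  rewrite (Rintegral_chasles (ltW a0) b0 lf) (E0 0 a)//.
  have -> : \int[mu]_(y in `[b, 0]) f y = 0.
    by move: b0; rewrite le_eqVlt => /predU1P[<-|/E0//]; rewrite Rintegral_seg1.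
  lra.
rewrite (Rintegral_chasles ab (ltW b0) lf) !(E0 0)//.
by lra.
Qed.

Section theory.
Variables (f F : R -> R).
Hypothesis fF : primitive f F.

Lemma primitive_locally_integrable : locally_integrable setT f. Proof. by case: fF. Qed.

Lemma primitive_continuous : continuous F.
Proof.
have [lf FE] := fF.
move=> x.
have x11 : x - 1 <= x + 1 by lra.
have /(parameterized_integral_continuous x11) :=
  locally_integrable_itv (x - 1) (x + 1) lf.
move=> /continuous_within_itvP-/(_ _)[]; first lra.
move=> /(_ x) /= /[!in_itv]/= cx _ _.
have {}cx : {for x, continuous (fun y => parameterized_integral mu (x - 1) y f)}.
  by apply: cx; lra.
have : {for x, continuous (fun y => parameterized_integral mu (x - 1) y f + F (x - 1))}.
  by apply: cvgD; [exact: cx|exact: cvg_cst].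
rewrite /prop_for /continuous_at /parameterized_integral FE ?subrK; last lra.
apply: cvg_trans; apply: near_eq_cvg; near=> y.
rewrite FE ?subrK//; near: y; apply: lt_le_nbhsr; lra.
Unshelve. all: by end_near. Qed.

Lemma primitive_derive x : {for x, continuous f} -> is_derive x (1 : R) F (f x).
Proof.
have [lf FE] := fF.
move=> cf; have xx : x < x + 1 by lra.
have [] := @continuous_FTC1 _ f (BLeft (x - 1)) x (x + 1) xx.
- exact: locally_integrable_itv.
- by rewrite lte_fin; lra.
- exact: cf.
set G := fun y => _.
move=> dG; rewrite derive1E => GE.
have : is_derive x (1 : R) (fun y => G y + F (x - 1)) (f x).
  rewrite -GE -['D_1 G x]addr0.
  by apply: is_deriveD; exact: derivableP.
apply: near_eq_is_derive.
near=> y.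
rewrite /G FE ?subrK//; near: y; apply: lt_le_nbhsr; lra.
Unshelve. all: by end_near. Qed.

(** Almost every point is a Lebesgue point of f. *)
Lemma primitive_ae_derive : {ae mu, forall x, F^`() x = f x}.
Proof.
have [lf FE] := fF.
have := lebesgue_differentiation lf.
apply: filterS; first exact: (ae_filter_ringOfSetsType mu).
move=> x fx.
have xx : x < x + 1 by lra.
have [] := @FTC1_lebesgue_pt _ f (BLeft (x - 1)) x (x + 1) xx.
- exact: locally_integrable_itv.
- by rewrite lte_fin; lra.
- exact: fx.
set G := fun y => _.
move=> dG <-; rewrite !derive1E.
rewrite -(addr0 ('D_1 G x)) -(derive_cst (F (x - 1)) x 1).
rewrite -(deriveD dG (derivable_cst (F (x - 1)) x 1)).
apply: near_eq_derive.
near=> y.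
rewrite !fctE /G FE ?subrK//; near: y; apply: lt_le_nbhsr; lra.
Unshelve. all: by end_near. Qed.

End theory.

Lemma derive_primitive f F : continuous f ->
  (forall x, is_derive x (1 : R) F (f x)) -> primitive f F.
Proof.
move=> cf Ff; have lf := continuous_locally_integrable cf; split => //.
have [G fG] := primitive_exists lf.
move=> a b ab; have [_ ->//] := fG.
suff FG0 x : is_derive x (1 : R) (F - G) 0.
  by have := is_derive_0_is_cst a b FG0; rewrite !fctE; lra.
rewrite -(subrr (f x)); apply: is_deriveB.
by apply: (primitive_derive fG); exact: cf.
Qed.

Lemma eq_primitive f g F : primitive f F -> f =1 g -> primitive g F.
Proof. by move=> fF /funext <-. Qed.

Lemma primitive_ext f F G : primitive f F -> F =1 G -> primitive f G.
Proof. by move=> fF /funext <-. Qed.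

Lemma primitiveD f g F G : primitive f F -> primitive g G ->
  primitive (fun x => f x + g x) (fun x => F x + G x).
Proof.
move=> [lf fF] [lg gG]; split; first exact: locally_integrableD.
move=> a b ab; rewrite RintegralD//; [|exact: locally_integrable_itv..].
by rewrite fF// gG//; lra.
Qed.

Lemma primitiveZ f F c : primitive f F ->
  primitive (fun x => c * f x) (fun x => c * F x).
Proof.
move=> [lf fF]; split; first exact: locally_integrableZ.
move=> a b ab; rewrite RintegralZl//; last exact: locally_integrable_itv.
by rewrite fF// mulrBr.
Qed.

Lemma primitive_ae_eq f g F : primitive f F -> locally_integrable setT g ->
  {ae mu, forall x, f x = g x} -> primitive g F.
Proof.
move=> [lf fF] lg fg; split => // a b ab; rewrite -fF//.
congr fine; apply: ae_eq_integral => //.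
- by have /integrableP[] := locally_integrable_itv a b lg.
- by have /integrableP[] := locally_integrable_itv a b lf.
- move: fg; apply: filterS; first exact: (ae_filter_ringOfSetsType mu).
  by move=> x /= -> .
Qed.

Lemma primitive_le f g F G a b : primitive f F -> primitive g G -> a <= b ->
  (forall x, a <= x <= b -> f x <= g x) -> F b - F a <= G b - G a.
Proof.
move=> [lf fF] [lg gG] ab fg; rewrite -fF// -gG//.
apply: le_Rintegral; [by []|exact: locally_integrable_itv|exact: locally_integrable_itv|].
by move=> x /=; rewrite in_itv/=; exact: fg.
Qed.

Lemma primitiveN f F : primitive f F ->
  primitive (fun x => - f x) (fun x => - F x).
Proof.
move=> /(primitiveZ (-1)) p.
by apply: primitive_ext (eq_primitive p _) _ => x; rewrite mulN1r.
Qed.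

Lemma primitiveB f g F G : primitive f F -> primitive g G ->
  primitive (fun x => f x - g x) (fun x => F x - G x).
Proof. by move=> fF /primitiveN gG; exact: primitiveD. Qed.

Lemma primitive_norm_le f g F G a b : primitive f F -> primitive g G -> a <= b ->
  (forall x, a <= x <= b -> `|f x| <= g x) -> `|F b - F a| <= G b - G a.
Proof.
move=> fF gG ab fg; rewrite ler_norml; apply/andP; split.
  have := primitive_le (primitiveN gG) fF ab.
  rewrite -opprD opprB addrC -opprB; apply => x xab.
  by have := fg x xab; rewrite ler_norml => /andP[].
apply: (primitive_le fF gG ab) => x xab.
by have := fg x xab; rewrite ler_norml => /andP[].
Qed.

Lemma derive_continuous (phi dphi : R -> R) :
  (forall x, is_derive x (1 : R) phi (dphi x)) -> continuous phi.
Proof.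
move=> dp x; apply: differentiable_continuous.
by apply/derivable1_diffP; apply: ex_derive.
Qed.

Lemma lipschitz_of_derive (phi dphi : R -> R) (L : R) a b :
  (forall x, is_derive x (1 : R) phi (dphi x)) -> a <= b ->
  (forall x, a <= x <= b -> `|dphi x| <= L) ->
  `|phi b - phi a| <= L * (b - a).
Proof.
move=> dp ab bL.
have [|c] := MVT_segment ab (fun x _ => dp x).
  exact: continuous_within_itv (derive_continuous dp).
rewrite in_itv/= => /bL cL ->.
by rewrite normrM (ger0_norm (_ : 0 <= b - a)) ?subr_ge0// ler_wpM2r ?subr_ge0.
Qed.

Lemma continuous_bounded g a b : continuous g -> exists2 L, 0 <= L &
  forall x, a <= x <= b -> `|g x| <= L.
Proof.
move=> cg; have [ab|ba] := leP a b; last first.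
  by exists 0 => // x; lra.
have /(EVT_max ab)[c _ cM] : {within `[a, b], continuous (fun x => `|g x|)}.
  by apply: continuous_within_itv => x; apply: cvg_norm; exact: cg.
by exists `|g c| => // x xab; apply: cM; rewrite in_itv.
Qed.

Lemma near0_norm_le (e : R) : 0 < e -> \forall h \near (0 : R), `|h| <= e.
Proof. by move=> e0; exact: (@nbhs0_le R R^o). Qed.

(** Product rule, hence integration by parts, for an indefinite integral F and a
    C^1 function phi.  Let H be a primitive of the expected density and
    D = F phi - H.  If |phi'| <= L near x and A is a primitive of |f|, then
    |D b - D a| <= 2 L (b - a) (A b - A a) for a <= b near x; as A is continuous,
    D has derivative 0 at every point, so D is constant. *)
Lemma primitiveM f F (phi dphi : R -> R) : primitive f F ->
  continuous dphi -> (forall x, is_derive x (1 : R) phi (dphi x)) ->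
  primitive (fun x => f x * phi x + F x * dphi x) (fun x => F x * phi x).
Proof.
move=> fF cdp dp; have [lf FE] := fF.
have cF := primitive_continuous fF.
have cp := derive_continuous dp.
have lh : locally_integrable setT (fun x => f x * phi x + F x * dphi x).
  apply: locally_integrableD; first exact: locally_integrableMr.
  by apply: continuous_locally_integrable => x; apply: cvgM; [exact: cF|exact: cdp].
have [H hH] := primitive_exists lh.
have [A fA] := primitive_exists (locally_integrable_norm lf).
suff FH0 x : is_derive x (1 : R) (fun x => F x * phi x - H x) 0.
  split => // a b ab; have [_ ->//] := hH.
  by have /= := is_derive_0_is_cst a b FH0; lra.
have [L L0 dpL] := continuous_bounded (x - 1) (x + 1) cdp.
have key a b : x - 1 <= a -> a <= b -> b <= x + 1 ->
    `|(F b * phi b - H b) - (F a * phi a - H a)| <=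
    2 * L * (b - a) * (A b - A a).
  move=> xa ab bx.
  have dphi_prim : primitive dphi phi by exact: derive_primitive.
  have P1 := primitiveB
    (primitiveD (primitiveZ (phi b) fF) (primitiveZ (F a) dphi_prim)) hH.
  have idp : primitive (cst 1) (id : R -> R).
    by apply: derive_primitive; exact: cst_continuous.
  have P2 := primitiveD (primitiveZ (L * (b - a)) fA)
               (primitiveZ (L * (A b - A a)) idp).
  have /= := primitive_norm_le P1 P2 ab.
  have -> : phi b * F b + F a * phi b - H b - (phi b * F a + F a * phi a - H a) =
    F b * phi b - H b - (F a * phi a - H a) by ring.
  have -> : L * (b - a) * A b + L * (A b - A a) * b -
     (L * (b - a) * A a + L * (A b - A a) * a) =
     2 * L * (b - a) * (A b - A a) by ring.
  move=> K; apply: K => y /andP[ay yb].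
  have -> : phi b * f y + F a * dphi y - (f y * phi y + F y * dphi y) =
    f y * (phi b - phi y) + (F a - F y) * dphi y by ring.
  apply: (le_trans (ler_normD _ _)); rewrite !normrM mulr1; apply: lerD.
    rewrite mulrC ler_wpM2r//.
    have : `|phi b - phi y| <= L * (b - y).
      by apply: lipschitz_of_derive dp yb _ => z zyb; apply: dpL; lra.
    move=> /le_trans; apply; apply: ler_wpM2l => //; lra.
  rewrite mulrC; apply: ler_pM => //; first by apply: dpL; lra.
  rewrite distrC; apply: (@le_trans _ _ (A y - A a)).
    exact: (primitive_norm_le fF fA ay).
  rewrite lerD2r -subr_ge0.
  have := primitive_le (primitiveZ 0 fA) fA yb.
  by rewrite !mul0r subrr; apply => z _; rewrite mul0r.
apply: is_derive_of_estimate => e e0.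
have cA : {for x, continuous A} by exact: (primitive_continuous fA).
have e1 : 0 < e / (2 * L + 1) by apply: divr_gt0 => //; lra.
have /= nA : \forall h \near (0 : R), `|A x - A (h + x)| < e / (2 * L + 1).
  have : (A \o shift x) h @[h --> (0 : R)] --> A x.
    by rewrite cvg_comp_shift add0r.
  by move/cvgrPdist_lt/(_ _ e1).
near=> h.
have h1 : `|h| <= 1 by near: h; exact: near0_norm_le.
have hA : `|A x - A (h + x)| < e / (2 * L + 1) by near: h.
rewrite mul0r subr0.
have dA : 2 * L * `|A x - A (h + x)| <= e.
  apply: (@le_trans _ _ ((2 * L + 1) * (e / (2 * L + 1)))).
    by apply: ler_pM => //; [lra|lra|exact: ltW].
  by rewrite mulrC divfK//; lra.
have [h0|h0] := leP 0 h.
  have := key x (x + h); rewrite ger0_norm in h1 => //.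
  move=> /(_ _ _ _)/le_trans; apply; [lra..|].
  rewrite -addrAC subrr add0r (ger0_norm h0) mulrAC ler_wpM2r//.
  apply: le_trans dA; rewrite ler_wpM2l; [by []|lra|].
  by rewrite distrC [h + x]addrC ler_norm.
have := key (x + h) x; rewrite ltr0_norm in h1 => //.
rewrite distrC.
move=> /(_ _ _ _)/le_trans; apply; [lra..|].
rewrite (ltr0_norm h0) opprD addrA subrr add0r mulrAC ler_wpM2r//; first lra.
apply: le_trans dA; rewrite ler_wpM2l; [by []|lra|].
by rewrite [h + x]addrC ler_norm.
Unshelve. all: by end_near. Qed.

Lemma continuous_primitive f : continuous f ->
  exists2 F, primitive f F & forall x, is_derive x (1 : R) F (f x).
Proof.
move=> cf; have [F fF] := primitive_exists (continuous_locally_integrable cf).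
by exists F => // x; apply: (primitive_derive fF); exact: cf.
Qed.

Lemma primitive_unique f F G a b : primitive f F -> primitive f G ->
  F b - F a = G b - G a.
Proof.
move=> [_ fF] [_ fG].
have [ab|ba] := leP a b; first by rewrite -fF// fG.
by rewrite -(opprB (F a)) -(opprB (G a)) -fF ?fG// ltW.
Qed.

End Primitives.

(** * Translations, reflections and periodicity *)

Section Invariance.
Context {R : realType}.
Notation mu := (@lebesgue_measure R).
Implicit Types (f g F : R -> R) (a b c x y : R).

Section isometry.
Variable phi : R -> R.
Hypothesis cphi : continuous phi.
Hypothesis phi_itv : forall a b, a <= b ->
  mu (phi @^-1` `]a, b]) = (b - a)%:E.

Let mphi : measurable_fun setT phi.
Proof. exact: continuous_measurable_fun. Qed.

(** Lebesgue measure is characterised by the lengths of half-open intervals, so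
    their preimages decide whether phi preserves it. *)
Lemma lebesgue_measure_isometry (A : set R) : measurable A ->
  mu (phi @^-1` A) = mu A.
Proof.
move=> mA.
have mphi' : measurable_fun [set: measurableTypeR R]
  (phi : measurableTypeR R -> measurableTypeR R) by exact: mphi.
pose mphi_mixin := isMeasurableFun.Build _ _ _ _ _ mphi'.
pose P : {mfun measurableTypeR R >-> measurableTypeR R} :=
  HB.pack (phi : measurableTypeR R -> measurableTypeR R) mphi_mixin.
apply/esym/(@lebesgue_measure_unique R (pushforward mu P)) => //.
move=> X [[a b] _ <-] /=.
rewrite /pushforward/=.
have [ab|ba] := leP a b; last first.
  by rewrite set_itv_ge ?preimage_set0 ?measure0// bnd_simp -leNgt ltW.
rewrite phi_itv// lebesgue_measure_itv/= lte_fin EFinB.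
by move: ab; rewrite le_eqVlt => /predU1P[->|->//]; rewrite ltxx subee.
Qed.

Lemma isometry_integrable f (D : set R) : measurable D ->
  measurable_fun setT f ->
  mu.-integrable D (EFin \o f) ->
  mu.-integrable (phi @^-1` D) (EFin \o (f \o phi)).
Proof.
move=> mD mf /integrableP[mfD fD].
have mfp : measurable_fun setT (f \o phi) by exact: measurableT_comp.
apply/integrableP; split.
  by apply/measurable_EFinP; exact: measurable_funTS.
have mphi' : measurable_fun [set: measurableTypeR R]
  (phi : measurableTypeR R -> measurableTypeR R) by exact: mphi.
have E := @ge0_integral_pushforward _ _ _ _ R _ mphi' mu D (fun x => `|(f x)%:E|%E).
apply: le_lt_trans fD; rewrite -[X in (X <= _)%E]E//; last exact: measurableT_comp.
rewrite (@eq_measure_integral _ (measurableTypeR R) R D mu)// => A mA _.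
exact: lebesgue_measure_isometry.
Qed.

Lemma isometry_Rintegral f (D : set R) : measurable D ->
  measurable_fun setT f ->
  mu.-integrable D (EFin \o f) ->
  \int[mu]_(x in phi @^-1` D) f (phi x) = \int[mu]_(x in D) f x.
Proof.
move=> mD mf fD.
have mphi' : measurable_fun [set: measurableTypeR R]
  (phi : measurableTypeR R -> measurableTypeR R) by exact: mphi.
congr fine.
have E := @integral_pushforward _ _ _ _ R _ mphi' mu D (EFin \o f).
rewrite -[LHS]E//; [|exact/measurable_EFinP|exact: isometry_integrable].
rewrite (@eq_measure_integral _ (measurableTypeR R) R D mu)// => A mA _.
exact: lebesgue_measure_isometry.
Qed.

End isometry.

Lemma shift_itv c a b : a <= b ->
  mu ((fun x => x + c) @^-1` `]a, b]) = (b - a)%:E.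
Proof.
move=> ab.
rewrite (_ : _ @^-1` _ = `]a - c, b - c]); last first.
  by apply/seteqP; split => x /=; rewrite !in_itv/=; lra.
rewrite lebesgue_measure_itv/= lte_fin ltrD2r.
move: ab; rewrite le_eqVlt => /predU1P[->|ab]; first by rewrite ltxx subrr.
by rewrite ab -EFinB; congr EFin; lra.
Qed.

Lemma opp_itv a b : a <= b ->
  mu ((fun x => - x) @^-1` `]a, b]) = (b - a)%:E.
Proof.
move=> ab.
rewrite (_ : _ @^-1` _ = `[- b, - a[); last first.
  by apply/seteqP; split => x /=; rewrite !in_itv/=; lra.
rewrite lebesgue_measure_itv/= lte_fin ltrN2.
move: ab; rewrite le_eqVlt => /predU1P[->|ab]; first by rewrite ltxx subrr.
by rewrite ab -EFinB; congr EFin; lra.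
Qed.

Lemma continuous_shiftc c : continuous (fun x : R => x + c).
Proof. by move=> x; apply: cvgD; [exact: cvg_id|exact: cvg_cst]. Qed.

Lemma primitive_shift f F c : primitive f F ->
  primitive (fun x => f (x + c)) (fun x => F (x + c)).
Proof.
move=> [lf fF]; have mf : measurable_fun setT f by case: lf.
have E a b : `[a, b] = (fun x => x + c) @^-1` `[a + c, b + c].
  by apply/seteqP; split => x /=; rewrite !in_itv/=; lra.
split.
  apply: locally_integrable_of_itv.
    apply: (@measurableT_comp _ _ _ _ _ _ f) => //.
    by apply: continuous_measurable_fun; exact: continuous_shiftc.
  move=> n; rewrite E; apply: (isometry_integrable (@continuous_shiftc c)) => //.
    exact: shift_itv.
  exact: locally_integrable_itv.
move=> a b ab; rewrite E (isometry_Rintegral (@continuous_shiftc c) (shift_itv c))//.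
  by rewrite fF// lerD2r.
exact: locally_integrable_itv.
Qed.

Lemma primitive_opp f F : primitive f F ->
  primitive (fun x => f (- x)) (fun x => - F (- x)).
Proof.
move=> [lf fF]; have mf : measurable_fun setT f by case: lf.
have E a b : `[a, b] = (fun x => - x) @^-1` `[- b, - a].
  by apply/seteqP; split => x /=; rewrite !in_itv/=; lra.
have cN : continuous (fun x : R => - x) by exact: opp_continuous.
split.
  apply: locally_integrable_of_itv; first exact: (@measurableT_comp _ _ _ _ _ _ f).
  move=> n; rewrite E; apply: (isometry_integrable cN) => //.
    exact: opp_itv.
  exact: locally_integrable_itv.
move=> a b ab; rewrite E (isometry_Rintegral cN opp_itv)//.
  by rewrite fF ?lerN2//; lra.
exact: locally_integrable_itv.
Qed.

(** The increment of F over any period is the integral over one period. *)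
Lemma primitive_periodic f F : primitive f F -> periodic f 2 ->
  forall x, F (x + 2) - F x = F 1 - F (-1).
Proof.
move=> fF pf x.
have F2 : primitive f (fun x => F (x + 2)).
  by apply: eq_primitive (primitive_shift 2 fF) _ => y; rewrite pf.
have := primitive_unique (-1) x F2 fF.
have -> : -1 + 2 = 1 :> R by lra.
lra.
Qed.

(** The derivative at x + 2 is also a derivative at x, by translation. *)
Lemma periodic_derive f (df : R -> R) : continuous df ->
  (forall x, is_derive x (1 : R) f (df x)) -> periodic f 2 -> periodic df 2.
Proof.
move=> cdf dfx pf x.
have p := primitive_shift 2 (derive_primitive cdf dfx).
have pfs : primitive (fun x => df (x + 2)) f.
  by apply: primitive_ext p _ => y; rewrite pf.
have cs : {for x, continuous (fun x => df (x + 2))}.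
  apply: (@continuous_comp _ _ _ (fun x => x + 2) df).
    exact: continuous_shiftc.
  exact: cdf.
have [_ <-] := primitive_derive pfs cs.
by have [_ <-] := dfx x.
Qed.

(** Subtract from z the nearest multiple of the period. *)
Lemma periodic_reduce (p : R -> R) z : periodic p 2 ->
  exists2 z', -1 <= z' <= 1 & p z = p z'.
Proof.
move=> pp.
have pn n u : p (u + 2 * n%:R) = p u.
  by rewrite mulr_natr; exact: periodicn.
have pz (k : int) u : p (u + 2 * k%:~R) = p u.
  case: k => n; first by rewrite -pmulrn pn.
  by rewrite NegzE mulrNz -pmulrn -[LHS](pn n.+1); congr (p _); ring.
pose k := Num.floor ((z + 1) / 2).
have k1 : k%:~R <= (z + 1) / 2 by exact: floor_le_tmp.
have k2 : (z + 1) / 2 < k%:~R + 1 by rewrite -intrD1 floorD1_gt.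
exists (z - 2 * k%:~R); first lra.
by rewrite -[RHS](pz k); congr (p _); ring.
Qed.

Lemma even_periodic_reduce (p : R -> R) z : (forall z, p (- z) = p z) ->
  periodic p 2 -> exists2 z', 0 <= z' <= 1 & p z = p z'.
Proof.
move=> pe pp; have [u u1 ->] := periodic_reduce z pp; exists `|u|.
  by rewrite normr_ge0 /= ler_norml.
by case: ger0P => _; rewrite ?pe.
Qed.

End Invariance.

(** * Square-integrable functions *)

Section SquareIntegrable.
Context {R : realType}.
Notation mu := (@lebesgue_measure R).
Implicit Types (f g F : R -> R) (a b c x y : R).

Lemma locally_integrable_le f g : measurable_fun setT f -> locally_integrable setT g ->
  (forall x, `|f x| <= g x) -> locally_integrable setT f.
Proof.
move=> mf lg fg; apply: locally_integrable_of_itv => // n.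
apply: (@le_integrable _ _ _ mu _ _ _ (EFin \o g)) => //.
- by apply/measurable_EFinP; apply: measurable_funTS.
- move=> x _ /=; rewrite lee_fin; apply: (le_trans (fg x)); exact: ler_norm.
- exact: locally_integrable_itv.
Qed.

Lemma L2_locM f g : L2_loc f -> L2_loc g ->
  locally_integrable setT (fun x => f x * g x).
Proof.
move=> [mf lf] [mg lg].
apply: (@locally_integrable_le _ (fun x => f x ^+ 2 + g x ^+ 2)).
- exact: measurable_funM.
- exact: locally_integrableD.
- by move=> x; rewrite ler_norml; apply/andP; split; nra.
Qed.

Lemma continuous_L2_loc f : continuous f -> L2_loc f.
Proof.
move=> cf; split; first exact: continuous_measurable_fun.
by apply: continuous_locally_integrable => x; apply: cvgM; exact: cf.
Qed.

Lemma L2_locD f g : L2_loc f -> L2_loc g -> L2_loc (fun x => f x + g x).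
Proof.
move=> [mf lf] [mg lg].
have mfg : measurable_fun setT (fun x => f x + g x) by exact: measurable_funD.
split => //.
apply: (@locally_integrable_le _ (fun x => 2 * (f x ^+ 2 + g x ^+ 2))).
- exact: measurable_funX.
- by apply: locally_integrableZ; exact: locally_integrableD.
- by move=> x; rewrite ger0_norm ?sqr_ge0//; have := sqr_ge0 (f x - g x); rewrite /=; nra.
Qed.

Lemma L2_locZ f c : L2_loc f -> L2_loc (fun x => c * f x).
Proof.
move=> [mf lf]; split; first exact: measurable_funM.
have -> : (fun x => (c * f x) ^+ 2) = (fun x => c ^+ 2 * f x ^+ 2).
  by apply/funext => x; rewrite exprMn.
exact: locally_integrableZ.
Qed.

Lemma L2_loc_locally_integrable f : L2_loc f -> locally_integrable setT f.
Proof.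
move=> Lf; have := L2_locM Lf (continuous_L2_loc (@cst_continuous _ _ (1 : R))).
by under eq_fun do rewrite /= mulr1.
Qed.

Lemma RintegralD_seg f g a b : locally_integrable setT f ->
  locally_integrable setT g ->
  \int[mu]_(x in `[a, b]) (f x + g x) =
  \int[mu]_(x in `[a, b]) f x + \int[mu]_(x in `[a, b]) g x.
Proof. by move=> lf lg; rewrite RintegralD//; exact: locally_integrable_itv. Qed.

Lemma RintegralZ_seg f c a b : locally_integrable setT f ->
  \int[mu]_(x in `[a, b]) (c * f x) = c * \int[mu]_(x in `[a, b]) f x.
Proof. by move=> lf; rewrite RintegralZl//; exact: locally_integrable_itv. Qed.

Lemma le_Rintegral_seg f g a b : locally_integrable setT f ->
  locally_integrable setT g -> (forall x, a <= x <= b -> f x <= g x) ->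
  \int[mu]_(x in `[a, b]) f x <= \int[mu]_(x in `[a, b]) g x.
Proof.
move=> lf lg fg.
apply: le_Rintegral; [by []|exact: locally_integrable_itv|exact: locally_integrable_itv|].
by move=> x /=; rewrite in_itv/=; exact: fg.
Qed.

(** The quadratic polynomial c |-> integral of (c f - g)^2 is nonnegative, so its
    discriminant is not positive. *)
Lemma cauchy_schwarz f g a b : L2_loc f -> L2_loc g ->
  (\int[mu]_(x in `[a, b]) (f x * g x)) ^+ 2 <=
  \int[mu]_(x in `[a, b]) (f x ^+ 2) * \int[mu]_(x in `[a, b]) (g x ^+ 2).
Proof.
move=> Lf Lg; set I := \int[mu]_(x in _) (_ * _); set U := Rintegral _ _ _.
set V := Rintegral _ _ _.
have U0 : 0 <= U by apply: Rintegral_ge0 => x _; exact: sqr_ge0.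
have V0 : 0 <= V by apply: Rintegral_ge0 => x _; exact: sqr_ge0.
have lf2 : locally_integrable setT (fun x => f x ^+ 2) by case: Lf.
have lg2 : locally_integrable setT (fun x => g x ^+ 2) by case: Lg.
have key c : 0 <= c ^+ 2 * U - 2 * c * I + V.
  have -> : c ^+ 2 * U - 2 * c * I + V =
      \int[mu]_(x in `[a, b]) ((c * f x - g x) ^+ 2).
    have -> : (fun x => (c * f x - g x) ^+ 2) =
      (fun x => c ^+ 2 * f x ^+ 2 + ((- 2 * c) * (f x * g x) + g x ^+ 2)).
      by apply/funext => x; ring.
    have lfg := L2_locM Lf Lg.
    have lfgz := locally_integrableZ (- 2 * c) lfg.
    have lz := locally_integrableZ (c ^+ 2) lf2.
    rewrite RintegralD_seg//; last exact: locally_integrableD.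
    by rewrite RintegralD_seg// !RintegralZ_seg// -/I -/U -/V; ring.
  by apply: Rintegral_ge0 => x _; exact: sqr_ge0.
have [U00|Un0] := eqVneq U 0.
  suff -> : I = 0 by rewrite expr0n/= U00 mul0r.
  apply/eqP/negP => /negP I0.
  have := key ((V + 1) / (2 * I)); rewrite U00 mulr0 sub0r.
  have -> : 2 * ((V + 1) / (2 * I)) * I = V + 1 by field.
  by lra.
have := key (I / U).
have -> : (I / U) ^+ 2 * U - 2 * (I / U) * I + V = (U * V - I ^+ 2) / U by field.
by rewrite pmulr_lge0 ?invr_gt0 ?lt_neqAle 1?eq_sym ?Un0// subr_ge0.
Qed.

Lemma sqr_le_norm (x y : R) : 0 <= y -> x ^+ 2 <= y ^+ 2 -> `|x| <= y.
Proof.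
move=> y0 xy.
by rewrite -(ler_pXn2r (n := 2))// ?nnegrE// real_normK ?num_real.
Qed.

Lemma cauchy_schwarz_le f g a b (y z : R) : L2_loc f -> L2_loc g ->
  0 <= y -> 0 <= z ->
  \int[mu]_(x in `[a, b]) (f x ^+ 2) <= y ^+ 2 ->
  \int[mu]_(x in `[a, b]) (g x ^+ 2) <= z ^+ 2 ->
  `|\int[mu]_(x in `[a, b]) (f x * g x)| <= y * z.
Proof.
move=> Lf Lg y0 z0 fy gz; apply: sqr_le_norm; first exact: mulr_ge0.
apply: (le_trans (cauchy_schwarz _ _ Lf Lg)); rewrite exprMn.
by apply: ler_pM => //; apply: Rintegral_ge0 => x _; exact: sqr_ge0.
Qed.

Lemma continuous_mul_locally_integrable f g : continuous f -> continuous g ->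
  locally_integrable setT (fun x => f x * g x).
Proof.
move=> cf cg; apply: continuous_locally_integrable => x.
by apply: cvgM; [exact: cf|exact: cg].
Qed.

End SquareIntegrable.

(** * The Wirtinger inequality *)

Section Wirtinger.
Context {R : realType}.
Notation mu := (@lebesgue_measure R).
Implicit Types (f g F : R -> R) (a b c x y : R).

(** Put l(x) = theta (x - a - 1/2).  For theta < pi the function tan (l x) is
    smooth on [a, a + 1], and
    (u')^2 - theta^2 u^2 + (theta tan(l) u^2)' = (u' + theta tan(l) u)^2 >= 0,
    where the term theta tan(l) u^2 vanishes at both ends.  The optimal theta = pi
    would make the tangent singular there. *)
Lemma dirichlet_poincare_lt_pi (u du : R -> R) a theta :
  (forall x, is_derive x (1 : R) u (du x)) -> continuous du ->
  u a = 0 -> u (a + 1) = 0 -> 0 < theta < pi ->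
  theta ^+ 2 * \int[mu]_(x in `[a, a + 1]) (u x ^+ 2) <=
  \int[mu]_(x in `[a, a + 1]) (du x ^+ 2).
Proof.
move=> dux cdu ua ua1 /andP[th0 thpi].
have cu := derive_continuous dux.
have lu2 : locally_integrable setT (fun x => u x ^+ 2).
  by have [] := continuous_L2_loc cu.
have ldu2 : locally_integrable setT (fun x => du x ^+ 2).
  by have [] := continuous_L2_loc cdu.
have [P Pp] := primitive_exists
  (locally_integrableD ldu2 (locally_integrableZ (- theta ^+ 2) lu2)).
have a1 : a <= a + 1 by lra.
pose l x := theta * (x - (a + 2^-1)).
pose Phi x := P x + theta * (tan (l x) * u x ^+ 2).
have lP x : a <= x <= a + 1 -> 0 < cos (l x).
  move=> xa; apply: cos_gt0_pihalf; rewrite /l; apply/andP; split; nra.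
have dPhi x : a <= x <= a + 1 -> is_derive x (1 : R) Phi
   ((du x + theta * tan (l x) * u x) ^+ 2).
  move=> xa; have cl := lP _ xa.
  have cl0 : cos (l x) != 0 by rewrite gt_eqF.
  have dl : is_derive x (1 : R) l theta.
    by rewrite /l; apply: is_derive_eq; rewrite subr0 [LHS]mulr1.
  have dt : is_derive x (1 : R) (fun x => tan (l x)) (theta * (cos (l x))^-2).
    have dtan := is_derive_tan cl0.
    by apply: is_derive_eq; rewrite mulrC.
  have dP : is_derive x (1 : R) P (du x ^+ 2 + - theta ^+ 2 * u x ^+ 2).
    apply: (primitive_derive Pp).
    apply: cvgD; first by apply: cvgM; exact: cdu.
    by apply: cvgM; [exact: cvg_cst|apply: cvgM; exact: cu].
  have du1 := dux x.
  rewrite /Phi; apply: is_derive_eq.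
  rewrite cos2_tan2// /GRing.scale/=; ring.
have : Phi a <= Phi (a + 1).
  apply: (@ger0_derive1_ndecr _ Phi a (a + 1)) => //.
  - move=> x; rewrite in_itv/= => xa.
    have := dPhi x; case; first by lra.
    by [].
  - move=> x; rewrite in_itv/= => xa; rewrite derive1E.
    have -> : 'D_1 Phi x = (du x + theta * tan (l x) * u x) ^+ 2.
      by have [|_ ->//] := dPhi x; lra.
    exact: sqr_ge0.
  - apply: derivable_within_continuous => x; rewrite in_itv/= => xa.
    by have [] := dPhi x xa.
rewrite /Phi/= ua ua1 expr0n/= !mulr0 !addr0 => PP.
have [_ /(_ _ _ a1)] := Pp.
by rewrite RintegralD_seg ?RintegralZ_seg//; [lra|exact: locally_integrableZ].
Qed.

(** The sharp constant is the limit theta -> pi of the previous lemma. *)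
Lemma dirichlet_poincare (u du : R -> R) a :
  (forall x, is_derive x (1 : R) u (du x)) -> continuous du ->
  u a = 0 -> u (a + 1) = 0 ->
  pi ^+ 2 * \int[mu]_(x in `[a, a + 1]) (u x ^+ 2) <=
  \int[mu]_(x in `[a, a + 1]) (du x ^+ 2).
Proof.
move=> dux cdu ua ua1.
set U := Rintegral _ _ _; set V := Rintegral _ _ _.
have U0 : 0 <= U by apply: Rintegral_ge0 => x _; exact: sqr_ge0.
have V0 : 0 <= V by apply: Rintegral_ge0 => x _; exact: sqr_ge0.
have pi0 : 0 < pi :> R := pi_gt0 R.
have key t : 0 < t < 1 -> t ^+ 2 * (pi ^+ 2 * U) <= V.
  move=> t01; rewrite mulrA -exprMn.
  by apply: (dirichlet_poincare_lt_pi dux cdu ua ua1); apply/andP; split; nra.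
rewrite leNgt; apply/negP => VX.
set X := pi ^+ 2 * U in key VX.
have X0 : 0 < X by exact: le_lt_trans VX.
(* t = 1 - s / 2 gives t^2 = 1 - s + s^2 / 4 > 1 - s = V / X. *)
pose s := 1 - V / X.
have VXs : V / X = 1 - s by rewrite /s; ring.
have s0 : 0 < s by rewrite /s subr_gt0 ltr_pdivrMr// mul1r.
have s1 : s <= 1 by rewrite /s lerBlDr lerDl divr_ge0// ltW.
have := key (1 - s / 2); rewrite -ler_pdivlMr// VXs.
have s2 : 0 < s ^+ 2 by rewrite exprn_gt0.
have -> : (1 - s / 2) ^+ 2 = 1 - s + s ^+ 2 / 4 by field.
by move=> h; have {h} := h ltac:(lra); lra.
Qed.

(** The primitive Psi of psi that vanishes at 0 also vanishes at -1 and 1, so the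
    Dirichlet inequality on both halves gives pi |Psi| <= |psi| in L^2.  Then
    |psi|^2 = - (integral of Psi psi') <= |Psi| |psi'| <= |psi| |psi'| / pi. *)
Lemma wirtinger (psi dpsi : R -> R) :
  (forall x, is_derive x (1 : R) psi (dpsi x)) -> continuous dpsi ->
  \int[mu]_(x in `[-1, 0]) psi x = 0 -> \int[mu]_(x in `[0, 1]) psi x = 0 ->
  pi ^+ 2 * \int[mu]_(x in `[-1, 1]) (psi x ^+ 2) <=
  \int[mu]_(x in `[-1, 1]) (dpsi x ^+ 2).
Proof.
move=> dpsix cdpsi I0 I1.
have cpsi := derive_continuous dpsix.
have lpsi := continuous_locally_integrable cpsi.
have [Psi0 Ppsi0] := primitive_exists lpsi.
pose Psi x := Psi0 x - Psi0 0.
have Ppsi : primitive psi Psi.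
  by split => // a b ab; rewrite /Psi; have [_ ->//] := Ppsi0; lra.
have dPsi x : is_derive x (1 : R) Psi (psi x).
  by apply: (primitive_derive Ppsi); exact: cpsi.
have cPsi := derive_continuous dPsi.
have Psi00 : Psi 0 = 0 by rewrite /Psi subrr.
have Psi1 : Psi 1 = 0.
  by have [_ /(_ 0 1 ler01)] := Ppsi; rewrite I1 Psi00 subr0.
have Psi_1 : Psi (-1) = 0.
  have [_ /(_ (-1) 0)] := Ppsi; rewrite I0 Psi00 sub0r => h.
  by have := h ltac:(lra); lra.
have D1 := dirichlet_poincare dPsi cpsi Psi00; rewrite add0r in D1; have {}D1 := D1 Psi1.
have D2 := dirichlet_poincare dPsi cpsi Psi_1; rewrite addNr in D2; have {}D2 := D2 Psi00.
have [mPsi lPsi2] := continuous_L2_loc cPsi.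
have [mpsi lpsi2] := continuous_L2_loc cpsi.
have l10 : -1 <= 0 :> R by lra.
have D : pi ^+ 2 * \int[mu]_(x in `[-1, 1]) (Psi x ^+ 2) <=
    \int[mu]_(x in `[-1, 1]) (psi x ^+ 2).
  by rewrite !(Rintegral_chasles l10 ler01)//; lra.
have [_ /(_ (-1) 1)] := primitiveM Ppsi cdpsi dpsix.
have l1 : locally_integrable setT (fun x => Psi x * dpsi x).
  by apply: continuous_locally_integrable => x; apply: cvgM; [exact: cPsi|exact: cdpsi].
have l2 : locally_integrable setT (fun x => psi x * psi x).
  by apply: continuous_locally_integrable => x; apply: cvgM; exact: cpsi.
rewrite /= Psi1 Psi_1 !mul0r subrr RintegralD_seg//.
move=> /(_ ltac:(lra)).
have := cauchy_schwarz (-1) 1 (continuous_L2_loc cPsi) (continuous_L2_loc cdpsi).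
move: D; set A := Rintegral _ _ _; set B := Rintegral _ _ _.
set C := Rintegral _ _ _; set E := Rintegral _ _ _.
have B0 : 0 <= B by apply: Rintegral_ge0 => x _; exact: sqr_ge0.
have E0 : 0 <= E by apply: Rintegral_ge0 => x _; exact: sqr_ge0.
move=> AB CAE /addr0_eq; move: CAE => + CB; rewrite -CB sqrrN => BAE.
have [->|Bn0] := eqVneq B 0; first by rewrite mulr0.
have Bp : 0 < B by rewrite lt_neqAle eq_sym Bn0.
rewrite -(ler_pM2r Bp); apply: (@le_trans _ _ (pi ^+ 2 * (A * E))).
  by rewrite -mulrA -expr2 ler_wpM2l// sqr_ge0.
by rewrite mulrA [leRHS]mulrC ler_wpM2r.
Qed.

End Wirtinger.

(** * Convolution with the kernel w *)

Section Convolution.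
Context {R : realType}.
Notation mu := (@lebesgue_measure R).
Implicit Types (f g F : R -> R) (a b c x y : R).

Variable r : R.
Hypothesis r0 : 0 < r.

Lemma w_convE f x :
  w_conv r f x = \int[mu]_(y in `[x - r, x + r]) ((x - y) * f y).
Proof.
rewrite /w_conv [RHS]Rintegral_mkcond; congr Rintegral; apply/funext => y.
rewrite patchE /w; case: ifPn => [xy|xy].
  by rewrite mem_set//= in_itv/=; move: xy; rewrite ler_norml; lra.
rewrite mul0r memNset//= in_itv/=; apply/negP; apply: contra xy => xy.
by rewrite ler_norml; lra.
Qed.

Let locally_integrable_lin f x : locally_integrable setT f ->
  locally_integrable setT (fun y => (x - y) * f y).
Proof.
move=> lf; rewrite (_ : (fun _ => _) = (fun y => f y * (x - y))).
  by apply: locally_integrableMr => // y; apply: cvgB; [exact: cvg_cst|exact: cvg_id].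
by apply/funext => y; rewrite mulrC.
Qed.

Lemma w_convD f g x : locally_integrable setT f -> locally_integrable setT g ->
  w_conv r (fun y => f y + g y) x = w_conv r f x + w_conv r g x.
Proof.
move=> lf lg; rewrite !w_convE -RintegralD_seg; [|exact: locally_integrable_lin..].
by apply: eq_Rintegral => y _; rewrite mulrDr.
Qed.

Lemma w_convZ f c x : locally_integrable setT f ->
  w_conv r (fun y => c * f y) x = c * w_conv r f x.
Proof.
move=> lf; rewrite !w_convE -RintegralZ_seg; last exact: locally_integrable_lin.
by apply: eq_Rintegral => y _; rewrite mulrCA.
Qed.

(** Integrating by parts against y |-> x - y expresses the convolution through
    iterated primitives of f; regularity and bounds are read off
    from this formula. *)
Lemma w_conv_by_parts f F FF x : primitive f F ->
  (forall x, is_derive x (1 : R) FF (F x)) ->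
  w_conv r f x = FF (x + r) - FF (x - r) - r * (F (x + r) + F (x - r)).
Proof.
move=> fF FFd; have cF := primitive_continuous fF.
have FFp := derive_primitive cF FFd.
have dl y : is_derive y (1 : R) (fun z => x - z) (-1).
  by apply: is_derive_eq; ring.
have := primitiveM fF (@cst_continuous _ _ (-1 : R)) dl.
move=> /primitiveD/(_ FFp) [_ /(_ (x - r) (x + r))].
have xr : x - r <= x + r by move: r0; lra.
move=> /(_ xr) /= E; rewrite w_convE.
transitivity (F (x + r) * (x - (x + r)) + FF (x + r) -
  (F (x - r) * (x - (x - r)) + FF (x - r))); last by ring.
by rewrite -E; apply: eq_Rintegral => y _; ring.
Qed.

Lemma w_conv_cst c x : w_conv r (fun=> c) x = 0.
Proof.
have dF y : is_derive y (1 : R) (fun z => c * z) c.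
  by apply: is_derive_eq; rewrite /GRing.scale/=; ring.
have dFF y : is_derive y (1 : R) (fun z => c / 2 * z ^+ 2) (c * y).
  apply: is_derive_eq; rewrite /GRing.scale/=.
  by field.
have pF := derive_primitive (@cst_continuous _ _ c) dF.
by rewrite (w_conv_by_parts _ pF dFF); field.
Qed.

Lemma w_conv_antiderivative f : locally_integrable setT f ->
  exists g, primitive g (w_conv r f).
Proof.
move=> /primitive_exists[F fF].
have [FF FFp dFF] := continuous_primitive (primitive_continuous fF).
have p1 := primitiveB (primitive_shift r FFp) (primitive_shift (- r) FFp).
have p2 := primitiveD (primitive_shift r fF) (primitive_shift (- r) fF).
have p3 := primitiveB p1 (primitiveZ r p2).
eexists; apply: primitive_ext p3 _ => x.
by rewrite (w_conv_by_parts _ fF dFF).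
Qed.

Lemma w_conv_continuous f : locally_integrable setT f -> continuous (w_conv r f).
Proof. by move=> /w_conv_antiderivative[g]; exact: primitive_continuous. Qed.

(** Translation of the integral that defines the convolution. *)
Lemma w_conv_periodic f : locally_integrable setT f -> periodic f 2 ->
  periodic (w_conv r f) 2.
Proof.
move=> lf pf x; rewrite !w_convE.
have [H Hp] := primitive_exists (locally_integrable_lin (x + 2) lf).
have Hp2 : primitive (fun y => (x - y) * f y) (fun y => H (y + 2)).
  apply: eq_primitive (primitive_shift 2 Hp) _ => y /=.
  by rewrite pf; congr (_ * _); ring.
have [_ ->] := Hp; last by move: r0; lra.
have [_ ->] := Hp2; last by move: r0; lra.
by congr (H _ - H _); ring.
Qed.

(** With p(z) = F(x + z) + F(x - z) the convolution is the integral over [0, r] of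
    p(z) - p(r), that is r (p(c) - p(r)) for some c.  As p is even and 2-periodic,
    c and r may be moved to [0, 1]; there p(u) - p(v) is a difference of two masses
    of f on disjoint subintervals of a period.  Thus no power of r is lost when
    the support of w covers several periods. *)
Lemma w_conv_bound f F x : primitive f F -> periodic f 2 ->
  (forall x, 0 <= f x) -> `|w_conv r f x| <= r * (F 1 - F (-1)).
Proof.
move=> fF pf f0.
have Fper := primitive_periodic fF pf.
have Fnd a b : a <= b -> F a <= F b.
  move=> ab; rewrite -subr_ge0; have [_ <-//] := fF.
  by apply: Rintegral_ge0 => y _.
have [FF FFp dFF] := continuous_primitive (primitive_continuous fF).
pose p z := F (x + z) + F (x - z).
have dP z : is_derive z (1 : R) (fun z => FF (x + z) - FF (x - z)) (p z).
  have d1 := dFF (x + z). have d2 := dFF (x - z).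
  have ? : is_derive z (1 : R) (fun z => FF (x + z)) (F (x + z)).
    by apply: is_derive_eq; rewrite /GRing.scale/=; ring.
  have ? : is_derive z (1 : R) (fun z => FF (x - z)) (- F (x - z)).
    by apply: is_derive_eq; rewrite /GRing.scale/=; ring.
  by apply: is_derive_eq; rewrite /p /GRing.scale/=; ring.
have [c _] := MVT_segment (ltW r0) (fun z _ => dP z)
  (continuous_within_itv (derive_continuous dP)).
rewrite !subr0 addr0 subrr subr0 => E.
rewrite (w_conv_by_parts _ fF dFF) E -/(p r).
have -> : p c * r - r * p r = r * (p c - p r) by ring.
rewrite normrM (gtr0_norm r0) ler_wpM2l ?(ltW r0)//.
have pe z : p (- z) = p z by rewrite /p opprK addrC.
have pp : periodic p 2.
  move=> z; rewrite /p; have := Fper (x + z); have := Fper (x - (z + 2)).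
  have -> : x - (z + 2) + 2 = x - z by ring.
  have -> : x + z + 2 = x + (z + 2) by ring.
  lra.
have key u v : 0 <= u -> u <= v -> v <= 1 -> `|p u - p v| <= F 1 - F (-1).
  move=> u0 uv v1; have := Fper (x - 1); have -> : x - 1 + 2 = x + 1 by ring.
  have := Fnd (x + u) (x + v); have := Fnd (x + v) (x + 1).
  have := Fnd (x - v) (x - u); have := Fnd (x - 1) (x - v).
  have := Fnd (x - u) (x + u).
  rewrite /p ler_norml => /(_ ltac:(lra)) + /(_ ltac:(lra)) + /(_ ltac:(lra)).
  by move=> + + + /(_ ltac:(lra)) + /(_ ltac:(lra)); lra.
have [u u01 ->] := even_periodic_reduce c pe pp.
have [v v01 ->] := even_periodic_reduce r pe pp.
have [uv|vu] := leP u v; first by apply: key; lra.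
by rewrite distrC; apply: key; lra.
Qed.

(** Cauchy-Schwarz bounds the square of the convolution at x by 2 r^3 / 3, the
    integral of w^2, times the mass of g^2 on [x - r, x + r]; integrating that
    mass over a period gives 2 r times the mass of one period. *)
Lemma w_conv_L2 g : L2_loc g -> periodic g 2 ->
  \int[mu]_(x in `[-1, 1]) (w_conv r g x ^+ 2) <=
  4 / 3 * r ^+ 4 * \int[mu]_(x in `[-1, 1]) (g x ^+ 2).
Proof.
move=> Lg pg.
have lg2 : locally_integrable setT (fun x => g x ^+ 2) by case: Lg.
have [A gA] := primitive_exists lg2.
have cA := primitive_continuous gA.
have Aper : forall x, A (x + 2) - A x = A 1 - A (-1).
  by apply: primitive_periodic gA _ => x; rewrite pg.
have [AA AAp dAA] := continuous_primitive cA.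
have pw x : w_conv r g x ^+ 2 <= 2 / 3 * r ^+ 3 * (A (x + r) - A (x - r)).
  have [_ <-] := gA; last by move: r0; lra.
  rewrite w_convE.
  have cl : continuous (fun y => x - y).
    by move=> y; apply: cvgB; [exact: cvg_cst|exact: cvg_id].
  apply: (le_trans (cauchy_schwarz _ _ (continuous_L2_loc cl) Lg)).
  have -> // : \int[mu]_(y in `[x - r, x + r]) (x - y) ^+ 2 = 2 / 3 * r ^+ 3.
  have dC y : is_derive y (1 : R) (fun y => - 3^-1 * (x - y) ^+ 3) ((x - y) ^+ 2).
    apply: is_derive_eq; rewrite /GRing.scale/=.
  by field.
  have [_ ->] := derive_primitive (fun y => cvgM (cl y) (cl y)) dC; last by move: r0; lra.
  by field.
have lw : locally_integrable setT (fun x => w_conv r g x ^+ 2).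
  apply: continuous_locally_integrable => x.
  by apply: cvgM; apply: w_conv_continuous; exact: L2_loc_locally_integrable.
have pA := primitiveZ (2 / 3 * r ^+ 3)
  (primitiveB (primitive_shift r AAp) (primitive_shift (- r) AAp)).
have lA := primitive_locally_integrable pA.
apply: (le_trans (le_Rintegral_seg lw lA (fun x _ => pw x))).
have [_ ->] := pA; last lra.
have [_ ->] := gA; last lra.
have dq s : is_derive s (1 : R) (fun s => AA (1 + s) - AA (-1 + s)) (A 1 - A (-1)).
  rewrite -(Aper (-1 + s)).
  have ? := dAA (1 + s); have ? := dAA (-1 + s).
  have ? : is_derive s (1 : R) (fun z => AA (1 + z)) (A (1 + s)).
    by apply: is_derive_eq; rewrite /GRing.scale/=; ring.
  have ? : is_derive s (1 : R) (fun z => AA (-1 + z)) (A (-1 + s)).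
    by apply: is_derive_eq; rewrite /GRing.scale/=; ring.
  by apply: is_derive_eq; congr (A _ - _); ring.
have rr : - r <= r by move: r0; lra.
have [c _] := MVT_segment rr (fun z _ => dq z)
  (continuous_within_itv (derive_continuous dq)).
move=> E; rewrite le_eqVlt; apply/orP; left; apply/eqP.
transitivity (2 / 3 * r ^+ 3 * ((A 1 - A (-1)) * (r - - r))); last by field.
by rewrite -E; ring.
Qed.

End Convolution.

(** * The energy inequality at a fixed time *)

Section Energy.
Context {R : realType}.
Notation mu := (@lebesgue_measure R).
Implicit Types (f g F : R -> R) (a b c x y : R).

(** The Gronwall form of the energy inequality.  Bounding K y by K z / p leaves
    2 k (- z^2 / p + z mu0) with k = a p - K, which is at most
    (k / p) (p^2 mu0^2 - z^2) by Young, and z >= p y.  It is linear in y^2 and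
    mu0^2, which avoids a case distinction on whether y exceeds mu0. *)
Lemma dissipation_young (p a K C m mu0 y z : R) : 0 < p ->
  0 <= K -> 0 <= z -> 0 < a * p - K -> p * y <= z ->
  C * m <= (a * p - K) * mu0 -> 0 <= y ->
  2 * (z * (- a * z + K * y + C * m)) <=
  (a * p - K) * p * (mu0 ^+ 2 - y ^+ 2).
Proof.
move=> p0 K0 z0 k0 yz Cm y0.
set k := a * p - K in k0 Cm *.
have aE : a = (k + K) / p by rewrite /k subrK mulfK// gt_eqF.
have yE : y <= z / p by rewrite ler_pdivlMr// mulrC.
apply: (@le_trans _ _ (2 * (z * (- a * z + K * (z / p) + k * mu0)))).
  apply: ler_wpM2l => //; apply: ler_wpM2l => //; apply: lerD => //.
  by rewrite lerD2l; exact: ler_wpM2l.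
have -> : - a * z + K * (z / p) + k * mu0 = k / p * (- z + p * mu0).
  by rewrite aE; field; rewrite gt_eqF.
have y2 : (p * y) ^+ 2 <= z ^+ 2 by rewrite ler_pXn2r// nnegrE; nra.
have -> : k * p * (mu0 ^+ 2 - y ^+ 2) =
    k / p * ((p * mu0) ^+ 2 - (p * y) ^+ 2) by field; rewrite gt_eqF.
have -> : 2 * (z * (k / p * (- z + p * mu0))) =
  k / p * (2 * z * (- z + p * mu0)) by ring.
apply: ler_wpM2l; first by rewrite divr_ge0// ltW.
have := sqr_ge0 (z - p * mu0); nra.
Qed.

Section ineq.
Variables (r M s : R) (rho d1 d2 q rr : R -> R).
Hypotheses (r0 : 0 < r) (M0 : 0 <= M).
Hypotheses (drho : forall x, is_derive x (1 : R) rho (d1 x))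
  (dd1 : forall x, is_derive x (1 : R) d1 (d2 x)) (cd2 : continuous d2).
Hypotheses (prho : periodic rho 2) (rho_ge0 : forall x, 0 <= rho x)
  (rho_l : \int[mu]_(x in `[-1, 0]) rho x = 1)
  (rho_r : \int[mu]_(x in `[0, 1]) rho x = 1).
Hypotheses (Lrr : L2_loc rr) (prr : periodic rr 2) (rr_ge0 : forall x, 0 <= rr x)
  (rr1 : \int[mu]_(x in `[-1, 1]) rr x = 2).
Hypotheses (cq : continuous q)
  (qE : forall x, q x = derive1 (fun y => rho y * G r M rr rho y) x
                        + s ^+ 2 / 2 * d2 x).

Let psi x := rho x - 1.
Let g := G r M rr rho.
Let l10 : -1 <= 0 :> R. Proof. by lra. Qed.
Let l11 : -1 <= 1 :> R. Proof. by lra. Qed.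

Let crho : continuous rho. Proof. exact: derive_continuous drho. Qed.
Let cd1 : continuous d1. Proof. exact: derive_continuous dd1. Qed.
Let lrho : locally_integrable setT rho. Proof. exact: continuous_locally_integrable. Qed.
Let lrr : locally_integrable setT rr. Proof. exact: L2_loc_locally_integrable. Qed.
Let lf : locally_integrable setT (fun y => rho y + M * rr y).
Proof. by apply: locally_integrableD => //; exact: locally_integrableZ. Qed.
Let dpsi x : is_derive x (1 : R) psi (d1 x).
Proof. by have ? := drho x; apply: is_derive_eq; rewrite subr0. Qed.
Let cpsi : continuous psi. Proof. exact: derive_continuous dpsi. Qed.
Let lpsi : locally_integrable setT psi. Proof. exact: continuous_locally_integrable. Qed.
Let cg : continuous g. Proof. exact: w_conv_continuous. Qed.

Let pf : periodic (fun y => rho y + M * rr y) 2.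
Proof. by move=> x; rewrite prho prr. Qed.

Let g_bound x : `|g x| <= r * (2 * (1 + M)).
Proof.
have [F Fp] := primitive_exists lf.
have := w_conv_bound r0 x Fp pf _.
have [_ <-//] := Fp.
rewrite RintegralD_seg//; last exact: locally_integrableZ.
rewrite RintegralZ_seg// rr1 (Rintegral_chasles l10 ler01)// rho_l rho_r.
have -> : 1 + 1 + M * 2 = 2 * (1 + M) by ring.
by apply=> y; rewrite addr_ge0// mulr_ge0.
Qed.

Let gE x : g x = w_conv r psi x + M * w_conv r rr x.
Proof.
rewrite /g /G w_convD//; last exact: locally_integrableZ.
rewrite w_convZ//; congr (_ + _).
rewrite -[RHS]addr0 -(w_conv_cst r0 1 x) -w_convD//; last first.
  by apply: continuous_locally_integrable; exact: cst_continuous.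
by congr w_conv; apply/funext => y; rewrite subrK.
Qed.

Let pP : periodic (fun y => rho y * g y) 2.
Proof. by move=> x; rewrite prho; congr (_ * _); exact: (w_conv_periodic r0 lf pf). Qed.

(** G is an indefinite integral, so the product rho G is one; its density agrees
    almost everywhere with the classical derivative in the equation, which is the
    continuous function q - (s^2 / 2) rho''.  This is what makes the integration by
    parts of the flux legitimate. *)
Let flux_primitive : primitive (fun x => q x - s ^+ 2 / 2 * d2 x)
  (fun y => rho y * g y).
Proof.
have [h hg] := w_conv_antiderivative r0 lf.
have := primitiveM hg cd1 drho.
move=> /(fun p => primitive_ext p (fun x => mulrC _ _)) Pp.
apply: (primitive_ae_eq Pp).
  apply: continuous_locally_integrable => x; apply: cvgB; first exact: cq.
  by apply: cvgM; [exact: cvg_cst|exact: cd2].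
have := primitive_ae_derive Pp.
apply: filterS; first exact: (ae_filter_ringOfSetsType mu).
by move=> x <-; rewrite qE addrK.
Qed.

(** Multiply q by psi and integrate by parts; periodicity cancels the boundary
    terms. *)
Lemma energy_identity :
  \int[mu]_(x in `[-1, 1]) (psi x * q x) =
  - (\int[mu]_(x in `[-1, 1]) (rho x * g x * d1 x))
  - s ^+ 2 / 2 * \int[mu]_(x in `[-1, 1]) (d1 x ^+ 2).
Proof.
have e1 : -1 + 2 = 1 :> R by lra.
have pd1 : periodic d1 2 by exact: periodic_derive drho prho.
have ppsi : psi 1 = psi (-1) by rewrite /psi -[in RHS]prho e1.
have p1 := primitiveM flux_primitive cd1 dpsi.
have p2 := primitiveZ (s ^+ 2 / 2) (primitiveM (derive_primitive cd2 dd1) cd1 dpsi).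
have [_ /(_ _ _ l11)] := primitiveD p1 p2.
rewrite /= ppsi.
have -> : d1 1 = d1 (-1) by rewrite -[in RHS]pd1 e1.
have -> : rho 1 * g 1 = rho (-1) * g (-1) by have := pP (-1); rewrite e1.
rewrite subrr => E.
have l1 := continuous_mul_locally_integrable cpsi cq.
have l2 : locally_integrable setT (fun x => rho x * g x * d1 x).
  apply: continuous_mul_locally_integrable => // x; apply: cvgM; [exact: crho|exact: cg].
have [_ l3] := continuous_L2_loc cd1.
have l3' := locally_integrableZ (s ^+ 2 / 2) l3.
have : \int[mu]_(x in `[-1, 1])
  (psi x * q x + (rho x * g x * d1 x + s ^+ 2 / 2 * d1 x ^+ 2)) = 0.
  by rewrite -[RHS]E; apply: eq_Rintegral => x _; ring.
rewrite RintegralD_seg//; last exact: locally_integrableD.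
rewrite RintegralD_seg// RintegralZ_seg//; lra.
Qed.

(** In the flux rho G = psi G + G the first term is bounded with the sup norm of
    G, and in the second G = w * psi + M (w * rr), since w annihilates constants,
    each part being bounded in L^2. *)
Lemma energy_estimate (y z m : R) :
  0 <= y -> 0 <= z -> 0 <= m ->
  y ^+ 2 = \int[mu]_(x in `[-1, 1]) (psi x ^+ 2) ->
  z ^+ 2 = \int[mu]_(x in `[-1, 1]) (d1 x ^+ 2) ->
  m ^+ 2 = \int[mu]_(x in `[-1, 1]) (rr x ^+ 2) ->
  pi * y <= z /\
  \int[mu]_(x in `[-1, 1]) (psi x * q x) <=
  z * (- (s ^+ 2 / 2) * z
       + (2 * r * (1 + M) + 2 * r ^+ 2 / Num.sqrt 3) * y
       + 2 * r ^+ 2 * M / Num.sqrt 3 * m).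
Proof.
move=> y0 z0 m0 yE zE mE; split.
  rewrite -(ler_pXn2r (n := 2))// ?nnegrE ?mulr_ge0 ?pi_ge0// exprMn yE zE.
  apply: wirtinger => //.
    rewrite (_ : psi = fun x => rho x + -1)// RintegralD_seg//; last first.
      by apply: continuous_locally_integrable; exact: cst_continuous.
    rewrite rho_l Rintegral_cst//= lebesgue_measure_itv/= lte_fin ltrN10/=.
    lra.
  rewrite (_ : psi = fun x => rho x + -1)// RintegralD_seg//; last first.
    by apply: continuous_locally_integrable; exact: cst_continuous.
  rewrite rho_r Rintegral_cst//= lebesgue_measure_itv/= lte_fin ltr01/=.
  lra.
rewrite energy_identity -zE.
have Lpsi := continuous_L2_loc cpsi.
have Ld1 := continuous_L2_loc cd1.
have cgd : continuous (fun x => g x * d1 x).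
  by move=> x; apply: cvgM; [exact: cg|exact: cd1].
have Lgd := continuous_L2_loc cgd.
set B := r * (2 * (1 + M)).
have B0 : 0 <= B by rewrite /B !mulr_ge0// ?addr_ge0// ltW.
have T1 : `|\int[mu]_(x in `[-1, 1]) (psi x * (g x * d1 x))| <= y * (B * z).
  apply: cauchy_schwarz_le => //; [exact: mulr_ge0|by rewrite yE|].
  rewrite exprMn zE -RintegralZ_seg; last by case: Ld1.
  apply: le_Rintegral_seg; [by case: Lgd|by apply: locally_integrableZ; case: Ld1|].
  move=> x _; rewrite exprMn ler_wpM2r ?sqr_ge0//.
  by rewrite -real_normK ?num_real// ler_pXn2r// nnegrE.
have sq3 : 0 < Num.sqrt 3 :> R by rewrite sqrtr_gt0; lra.
set c := 2 * r ^+ 2 / Num.sqrt 3.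
have c0 : 0 <= c by rewrite /c divr_ge0 ?mulr_ge0 ?sqr_ge0// ltW.
have cE : c ^+ 2 = 4 / 3 * r ^+ 4.
  rewrite /c !exprMn exprVn sqr_sqrtr; last lra.
  by field.
have TW f (u : R) : L2_loc f -> periodic f 2 -> 0 <= u ->
    u ^+ 2 = \int[mu]_(x in `[-1, 1]) (f x ^+ 2) ->
    `|\int[mu]_(x in `[-1, 1]) (w_conv r f x * d1 x)| <= c * u * z.
  move=> Lf pff u0 uE.
  apply: cauchy_schwarz_le => //; [|exact: mulr_ge0| |by rewrite zE].
    apply: continuous_L2_loc; apply: w_conv_continuous => //.
    exact: L2_loc_locally_integrable.
  by rewrite exprMn cE uE; exact: w_conv_L2.
have T2 := TW _ _ Lpsi _ y0 yE.
have T3 := TW _ _ Lrr prr m0 mE.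
have cW f : locally_integrable setT f ->
    locally_integrable setT (fun x => w_conv r f x * d1 x).
  by move=> lff; apply: continuous_mul_locally_integrable => //; exact: w_conv_continuous.
have -> : \int[mu]_(x in `[-1, 1]) (rho x * g x * d1 x) =
  \int[mu]_(x in `[-1, 1]) (psi x * (g x * d1 x)) +
  (\int[mu]_(x in `[-1, 1]) (w_conv r psi x * d1 x) +
   M * \int[mu]_(x in `[-1, 1]) (w_conv r rr x * d1 x)).
  have lw1 := cW _ lpsi; have lw2 := cW _ lrr; have lw2' := locally_integrableZ M lw2.
  have lpg := continuous_mul_locally_integrable cpsi cgd.
  have lw : locally_integrable setT (fun x => w_conv r psi x * d1 x +
      M * (w_conv r rr x * d1 x)) by exact: locally_integrableD lw1 lw2'.
  rewrite -(RintegralZ_seg M (-1) 1 lw2) -(RintegralD_seg (-1) 1 lw1 lw2').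
  rewrite -(RintegralD_seg (-1) 1 lpg lw).
  by apply: eq_Rintegral => x _; rewrite /psi gE; ring.
have ppsi : periodic psi 2 by move=> x; rewrite /psi prho.
have {}T2 := T2 ppsi.
move: T1 T2 T3; rewrite !ler_norml => /andP[T1 _] /andP[T2 _] /andP[T3 _].
have := ler_wpM2l M0 T3.
rewrite -/c (_ : 2 * r ^+ 2 * M / Num.sqrt 3 = c * M); last by rewrite /c; ring.
rewrite (_ : 2 * r * (1 + M) = B); last by rewrite /B; ring.
rewrite /psi in T1 T2 *.
move: T1 T2.
set X1 := Rintegral _ _ _; set X2 := Rintegral _ _ _; set X3 := Rintegral _ _ _.
by move=> T1 T2 T3'; lra.
Qed.

End ineq.
End Energy.

(** * Time evolution of the energy *)

Section Evolution.
Context {R : realType}.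
Notation mu := (@lebesgue_measure R).
Implicit Types (f g F : R -> R) (a b c x y : R).

Lemma L2normE f : L2_loc f ->
  L2norm f = (Num.sqrt (\int[mu]_(x in `[-1, 1]) (f x ^+ 2)))%:E.
Proof.
move=> [_ lf2]; rewrite /L2norm unlock.
rewrite (_ : (\int[mu]_x _ = (\int[mu]_(x in `[-1, 1]) (f x ^+ 2))%:E)%E).
  rewrite poweR_EFin powR12_sqrt//.
  by apply: Rintegral_ge0 => x _; exact: sqr_ge0.
rewrite /Rintegral fineK; last first.
  by apply: integrable_fin_num => //; exact: (locally_integrable_itv (-1) 1 lf2).
rewrite [RHS]integral_mkcond/=; apply: eq_integral => x _.
rewrite /= !patchE; case: ifPn => _ /=.
  by rewrite powR_mulrn// real_normK// num_real.
by rewrite -[point]/(0 : R) normr0 powR0.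
Qed.

Lemma sup_ge0 (A : set R) : (forall x, A x -> 0 <= x) -> 0 <= sup A.
Proof.
move=> A0; have [sA|nA] := pselect (has_sup A); last by rewrite sup_out.
have [[x Ax] ubA] := sA; apply: (le_trans (A0 _ Ax)); exact: ub_le_sup.
Qed.

(** The set of values is bounded on the compact interval, so its supremum is not
    the default value. *)
Lemma le_C2_norm f x : continuous f -> -1 <= x <= 1 -> `|f x| <= C2_norm f.
Proof.
move=> cf x11; rewrite /C2_norm big_ord_recl.
apply: (@le_trans _ _ (sup [set `|f^`(0) x0| | x0 in `[-1, 1]])).
  apply: ub_le_sup; last by exists x => //=; rewrite in_itv.
  have [L _ fL] := continuous_bounded (-1) 1 cf.
  by exists L => _ [y /= y11 <-]; apply: fL; rewrite in_itv/= in y11.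
rewrite lerDl; apply: sumr_ge0 => i _; apply: sup_ge0 => _ [y _ <-].
exact: normr_ge0.
Qed.

Lemma C2_ep_derive f : C2_ep f ->
  [/\ forall x, is_derive x (1 : R) f (derive1 f x),
      forall x, is_derive x (1 : R) (derive1 f) (derive1n 2 f x) &
      continuous (derive1n 2 f)].
Proof.
move=> [_ _ df c2]; split; [move=> x|move=> x|exact: c2].
- by have /derivableP := df 0 x isT; rewrite -derive1E.
- by have /derivableP := df 1 x isT; rewrite -derive1E.
Qed.

Lemma C2_ep_continuous f : C2_ep f -> continuous f.
Proof. by move=> /C2_ep_derive[/derive_continuous]. Qed.

Lemma Rintegral_sym_bound f c : locally_integrable setT f ->
  (forall x, -1 <= x <= 1 -> `|f x| <= c) ->
  `|\int[mu]_(x in `[-1, 1]) f x| <= 2 * c.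
Proof.
move=> lf fc; have [F fF] := primitive_exists lf.
have idp : primitive (cst c) (fun x => c * x).
  apply: derive_primitive; first exact: cst_continuous.
  by move=> y; apply: is_derive_eq; rewrite [LHS]mulr1.
have l11 : -1 <= 1 :> R by lra.
have [_ ->//] := fF; have := primitive_norm_le fF idp l11 fc.
by move=> /le_trans; apply; lra.
Qed.

(** The property that C1_C2_ep asserts of some time derivative, made available
    for a named one. *)
Definition C1_C2_derivative (rho rho' : R -> R -> R) :=
  forall t, 0 < t ->
    [/\ C2_ep (rho t), C2_ep (rho' t),
        C2_norm (fun x => h^-1 * (rho (t + h) x - rho t x) - rho' t x)
          @[h --> 0^'] --> 0 &
        C2_norm (fun x => rho' s x - rho' t x) @[s --> t] --> 0].

Section evolution.
Variables (rho rho' : R -> R -> R).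
Hypothesis C1rho : C1_C2_derivative rho rho'.

Let E t := \int[mu]_(x in `[-1, 1]) ((rho t x - 1) ^+ 2).

(** Periodicity extends the uniform convergence on [-1, 1] contained in the
    C^2 norm to the whole line. *)
Lemma uniform_derivative (t e : R) : 0 < t -> 0 < e ->
  \forall h \near (0 : R), forall x,
    `|rho (t + h) x - rho t x - rho' t x * h| <= e * `|h|.
Proof.
move=> t0 e0; have [Ct C't lim _] := C1rho t0.
have /= near1 : \forall h \near (0 : R)^',
    `|0 - C2_norm (fun x => h^-1 * (rho (t + h) x - rho t x) - rho' t x)| < e.
  by move/cvgrPdist_lt : lim => /(_ _ e0).
have := near1; rewrite near_withinE => {}near1.
near=> h; have [->|h0] := eqVneq h 0.
  by move=> x; rewrite addr0 mulr0 normr0 mulr0 subr0 subrr normr0.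
have ht : - t < h.
  have : `|h| < t by near: h; exact: (@nbhs0_lt R R^o).
  by rewrite ltr_norml => /andP[].
have th : 0 < t + h by lra.
have [Cth _ _ _] := C1rho th.
have cth := C2_ep_continuous Cth; have ct := C2_ep_continuous Ct.
have c't := C2_ep_continuous C't.
have [_ pth _ _] := Cth; have [_ pt _ _] := Ct; have [_ p't _ _] := C't.
set D := fun x => h^-1 * (rho (t + h) x - rho t x) - rho' t x.
have De : `|0 - C2_norm D| < e.
  rewrite /D; move: h0; near: h; exact: near1.
have cD : continuous D.
  move=> x; apply: cvgB; last exact: c't.
  apply: cvgM; first exact: cvg_cst.
  by apply: cvgB; [exact: cth|exact: ct].
have pD : periodic D 2 by move=> x; rewrite /D pth pt p't.
move=> x; have [u u11 uE] := periodic_reduce x pD.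
have : `|D x| <= e.
  rewrite uE; apply: (le_trans (le_C2_norm cD u11)).
  by apply: (le_trans (ler_norm _)); rewrite -normrN -sub0r ltW.
rewrite -(ler_pM2r (x := `|h|)) ?normr_gt0// -normrM; apply: le_trans.
by rewrite /D mulrBl mulrAC mulVf// mul1r.
Unshelve. all: by end_near. Qed.

Lemma pointwise_derivative (t x : R) : 0 < t ->
  is_derive t (1 : R) (fun s => rho s x) (rho' t x).
Proof.
move=> t0; apply: is_derive_of_estimate => e e0.
by have := uniform_derivative t0 e0; apply: filterS => h.
Qed.

(** Differentiation under the integral sign, from the uniform estimate: if
    d = rho(t + h) - rho(t) = h rho'(t) + eta with |eta| <= e |h|, the increment of
    the energy is h (2 psi rho') + 2 psi eta + d^2 under the integral. *)
Lemma energy_derivative (t : R) : 0 < t ->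
  is_derive t (1 : R) E (2 * \int[mu]_(x in `[-1, 1]) ((rho t x - 1) * rho' t x)).
Proof.
move=> t0; apply: is_derive_of_estimate => eps eps0.
have [Ct C't _ _] := C1rho t0.
have ct := C2_ep_continuous Ct; have c't := C2_ep_continuous C't.
have cp : continuous (fun x => rho t x - 1).
  by move=> x; apply: cvgB; [exact: ct|exact: cvg_cst].
have [B1 B10 B1P] := continuous_bounded (-1) 1 cp.
have [B2 B20 B2P] := continuous_bounded (-1) 1 c't.
pose B := B1 + B2 + 1.
have B0 : 0 < B by rewrite /B; lra.
(* The term 2 psi eta costs eps / 4 by the choice of e, the term d^2 another
   eps / 4 for |h| <= eps / (4 (B + 1)^2); the interval has length 2. *)
pose e := Num.min 1 (eps / (8 * B)).
have e0 : 0 < e by rewrite lt_min ltr01 divr_gt0//; lra.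
have e1 : e <= 1 by rewrite ge_min lexx.
have eB : 4 * (B * e) <= eps / 2.
  have : e <= eps / (8 * B) by rewrite ge_min lexx orbT.
  by rewrite ler_pdivlMr; lra.
have d0 : 0 < eps / (4 * (B + 1) ^+ 2).
  by rewrite divr_gt0// mulr_gt0// exprn_gt0//; lra.
have near1 := uniform_derivative t0 e0.
near=> h.
have hd : `|h| <= eps / (4 * (B + 1) ^+ 2) by near: h; exact: near0_norm_le.
have ht : - t < h.
  have : `|h| < t by near: h; exact: (@nbhs0_lt R R^o).
  by rewrite ltr_norml => /andP[].
have th : 0 < t + h by lra.
have H : forall x, `|rho (t + h) x - rho t x - rho' t x * h| <= e * `|h|.
  by near: h; exact: near1.
have [Cth _ _ _] := C1rho th; have cth := C2_ep_continuous Cth.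
have cph : continuous (fun x => rho (t + h) x - 1).
  by move=> x; apply: cvgB; [exact: cth|exact: cvg_cst].
have [_ lth] := continuous_L2_loc cph.
have [_ lt2] := continuous_L2_loc cp.
have lm := continuous_mul_locally_integrable cp c't.
have lm2 := locally_integrableZ (2 * h) lm.
have -> : E (t + h) - E t -
    2 * \int[mu]_(x in `[-1, 1]) ((rho t x - 1) * rho' t x) * h =
  \int[mu]_(x in `[-1, 1]) ((rho (t + h) x - 1) ^+ 2 +
    (-1 * (rho t x - 1) ^+ 2 + (- (2 * h)) * ((rho t x - 1) * rho' t x))).
  have l1 := locally_integrableZ (-1) lt2; have l2 := locally_integrableZ (- (2 * h)) lm.
  rewrite RintegralD_seg//; last exact: locally_integrableD.
  by rewrite RintegralD_seg// !RintegralZ_seg// /E; ring.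
apply: (@le_trans _ _ (2 * (eps / 2 * `|h|))); last by lra.
apply: Rintegral_sym_bound.
  apply: locally_integrableD => //.
  by apply: locally_integrableD; exact: locally_integrableZ.
move=> x x11.
set d := rho (t + h) x - rho t x; set eta := d - rho' t x * h.
have -> : (rho (t + h) x - 1) ^+ 2 + (-1 * (rho t x - 1) ^+ 2 +
   - (2 * h) * ((rho t x - 1) * rho' t x)) =
   2 * (rho t x - 1) * eta + d ^+ 2 by rewrite /eta /d; ring.
have etaP : `|eta| <= e * `|h| := H x.
have P1 := B1P x x11; have P2 := B2P x x11.
have dP : `|d| <= (B + 1) * `|h|.
  have -> : d = eta + rho' t x * h by rewrite /eta subrK.
  apply: (le_trans (ler_normD _ _)); rewrite normrM.
  have : `|rho' t x| * `|h| <= B * `|h| by apply: ler_wpM2r => //; rewrite /B; lra.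
  have : e * `|h| <= 1 * `|h| by apply: ler_wpM2r.
  by lra.
apply: (le_trans (ler_normD _ _)); rewrite !normrM (ger0_norm (_ : 0 <= 2))//.
have Q1 : 2 * `|rho t x - 1| * `|eta| <= eps / 4 * `|h|.
  apply: (@le_trans _ _ (2 * B * (e * `|h|))).
    by apply: ler_pM => //; rewrite ?mulr_ge0// ler_wpM2l// /B; lra.
  rewrite mulrA; apply: ler_wpM2r => //; lra.
have Q2 : `|d| * `|d| <= eps / 4 * `|h|.
  rewrite -expr2.
  apply: (@le_trans _ _ (((B + 1) * `|h|) ^+ 2)).
    by rewrite ler_pXn2r// nnegrE// mulr_ge0//; lra.
  rewrite exprMn expr2 mulrA; apply: ler_wpM2r => //.
  have b2 : 0 < (B + 1) ^+ 2 by rewrite exprn_gt0//; lra.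
  by move: hd; rewrite ler_pdivlMr; lra.
lra.
Unshelve. all: by end_near. Qed.

(** (E - c) e^(k t) is nonincreasing. *)
Lemma energy_gronwall (k c : R) :
  (forall t : R, 0 < t ->
     2 * \int[mu]_(x in `[-1, 1]) ((rho t x - 1) * rho' t x) <= k * (c - E t)) ->
  forall s t : R, 0 < s -> s <= t -> E t <= c + (E s - c) * expR (- (k * (t - s))).
Proof.
move=> dE s t s0 st.
pose H (u : R) := (E u - c) * expR (k * u).
have dH (u : R) : 0 < u -> is_derive u (1 : R) H
   ((2 * \int[mu]_(x in `[-1, 1]) ((rho u x - 1) * rho' u x) + k * (E u - c))
    * expR (k * u)).
  move=> u0; have ? := energy_derivative u0.
  have ? := is_derive_expR (k * u).
  rewrite /H; apply: is_derive_eq; rewrite /GRing.scale/=; ring.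
have Hst : H t <= H s.
  apply: (@ler0_derive1_nincr _ H s t) => //.
  - by move=> u; rewrite in_itv/= => /andP[su _]; have [] := dH u (lt_trans s0 su).
  - move=> u; rewrite in_itv/= => /andP[su _].
    have u0 := lt_trans s0 su; have [_] := dH u u0; rewrite derive1E => ->.
    apply: mulr_le0_ge0; last exact: expR_ge0.
    by have := dE u u0; lra.
  - apply: derivable_within_continuous => u; rewrite in_itv/= => /andP[su _].
    by have [] := dH u (lt_le_trans s0 su).
move: Hst; rewrite /H -ler_pdivlMr ?expR_gt0// -expRN -mulrA -expRD.
rewrite lerBlDl => /le_trans; apply.
by rewrite le_eqVlt; apply/orP; left; apply/eqP; congr (_ + _ * expR _); ring.
Qed.

End evolution.
End Evolution.

(** * Even probability densities *)

Section Density.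
Context {R : realType}.
Notation mu := (@lebesgue_measure R).
Implicit Types (f g F : R -> R) (a b c x y : R).

Lemma P_e_ge0 f : P_e f -> periodic f 2 -> forall x, 0 <= f x.
Proof.
by move=> [f0 _ _] pf x; have [u u11 ->] := periodic_reduce x pf; exact: f0.
Qed.

Lemma P_e_mass_r f : P_e f -> \int[mu]_(x in `[0, 1]) f x = 1.
Proof. by move=> [_ _ f1]; rewrite /Rintegral f1. Qed.

(** Reflection carries the mass of the right half to the left half. *)
Lemma P_e_mass_l f : P_e f -> locally_integrable setT f ->
  \int[mu]_(x in `[-1, 0]) f x = 1.
Proof.
move=> fP lf; have [_ fe _] := fP; have [F fF] := primitive_exists lf.
transitivity (\int[mu]_(x in `[-1, 0]) f (- x)).
  apply: eq_Rintegral => x; rewrite inE/= in_itv/= => x10.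
  by rewrite fe//; lra.
have [_ ->] := primitive_opp fF; last lra.
have [_ /(_ _ _ ler01)] := fF; rewrite P_e_mass_r// => E.
by rewrite oppr0 !opprK; lra.
Qed.

End Density.

(** * Exponential decay *)

Section Decay.
Context {R : realType}.
Notation mu := (@lebesgue_measure R).
Variables (r M sigma : R).

(** The margin kappa by which diffusion dominates the interaction: pi times
    the diffusion coefficient minus the coefficient K of the energy inequality. *)
Definition coercivity : R := sigma ^+ 2 / 2 * pi -
  (2 * r * (1 + M) + 2 * r ^+ 2 / Num.sqrt 3).

Hypotheses (r0 : 0 < r) (M0 : 0 <= M).

(** Multiplied by pi / 2 the assumption reads
    kappa > 2 r + 2 r^2 M eta / sqrt 3. *)
Lemma coercivity_gt0 (eta : R) : 0 < eta ->
  sigma_b2 r M + eta * c_b r M < sigma ^+ 2 ->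
  0 < coercivity /\
  2 * r ^+ 2 * M / Num.sqrt 3 * eta <= coercivity.
Proof.
move=> eta0.
have sq3 : 0 < Num.sqrt 3 :> R by rewrite sqrtr_gt0; lra.
have pi0 : 0 < pi :> R := pi_gt0 R.
rewrite -(ltr_pM2r (x := pi / 2)) ?divr_gt0//.
rewrite /coercivity /sigma_b2 /c_b.
move: sq3 pi0; move: (Num.sqrt 3) (pi : R) => q p q0 p0.
have -> : (4 * r / p * (M + r / q + 2) + eta * (4 * r ^+ 2 * M / (p * q))) *
   (p / 2) = 2 * r * (1 + M) + 2 * r ^+ 2 / q + 2 * r
     + 2 * r ^+ 2 * M / q * eta.
  by field; rewrite !gt_eqF.
have -> : sigma ^+ 2 * (p / 2) = sigma ^+ 2 / 2 * p by ring.
have : 0 <= 2 * r ^+ 2 * M / q * eta.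
  by rewrite !mulr_ge0 ?invr_ge0 ?(ltW eta0) ?(ltW q0) ?(ltW r0).
by move=> h h'; move: r0; split; lra.
Qed.

(** The energy inequality along a solution, with mu = |rho_r| / eta; the time
    derivative of the energy appears on the left. *)
Lemma dissipation (rho0 rho_r : R -> R) (rho rho' : R -> R -> R) (eta : R) :
  solution r M sigma rho0 rho_r rho ->
  H_ep 2 rho_r -> P_e rho_r ->
  C1_C2_derivative rho rho' ->
  0 < eta ->
  sigma_b2 r M + eta * c_b r M < sigma ^+ 2 ->
  forall t : R, 0 < t ->
     2 * \int[mu]_(x in `[-1, 1]) ((rho t x - 1) * rho' t x) <=
     coercivity * pi *
       ((Num.sqrt (\int[mu]_(x in `[-1, 1]) (rho_r x ^+ 2)) / eta) ^+ 2
        - \int[mu]_(x in `[-1, 1]) ((rho t x - 1) ^+ 2)).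
Proof.
move=> [_ rhoP pde _ _] [[prr [Lrr _]] _] rrP C1rho eta0 hs t t0.
have [k0 kC] := coercivity_gt0 eta0 hs.
have [Ct C't _ _] := C1rho t t0.
have [d1 d2 cd2] := C2_ep_derive Ct.
have [_ pt _ _] := Ct.
have tP := rhoP t (ltW t0).
have ct := C2_ep_continuous Ct.
have lt := continuous_locally_integrable ct.
have lrr := L2_loc_locally_integrable Lrr.
have rr1 : \int[mu]_(x in `[-1, 1]) rho_r x = 2.
  have l10 : -1 <= 0 :> R by lra.
  rewrite (Rintegral_chasles l10 ler01 lrr).
  by rewrite P_e_mass_r// P_e_mass_l//; lra.
have qE x : rho' t x = derive1 (fun y => rho t y * G r M rho_r (rho t) y) x
    + sigma ^+ 2 / 2 * derive1n 2 (rho t) x.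
  rewrite -pde// derive1E.
  by have [_ ->] := pointwise_derivative C1rho x t0.
have I0 f : 0 <= \int[mu]_(x in `[-1, 1]) (f x ^+ 2 : R).
  by apply: Rintegral_ge0 => x _; exact: sqr_ge0.
set m2 := \int[mu]_(x in `[-1, 1]) (rho_r x ^+ 2).
set E := \int[mu]_(x in `[-1, 1]) ((rho t x - 1) ^+ 2).
set Z := \int[mu]_(x in `[-1, 1]) (derive1 (rho t) x ^+ 2).
pose y := Num.sqrt E; pose z := Num.sqrt Z; pose m := Num.sqrt m2.
have [yz est] := energy_estimate r0 M0 d1 d2 cd2 pt (P_e_ge0 tP pt)
  (P_e_mass_l tP lt) (P_e_mass_r tP) Lrr prr (P_e_ge0 rrP prr) rr1
  (C2_ep_continuous C't) qE (sqrtr_ge0 E) (sqrtr_ge0 Z) (sqrtr_ge0 m2)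
  (sqr_sqrtr (I0 _)) (sqr_sqrtr (I0 _)) (sqr_sqrtr (I0 _)).
rewrite -/y -/z -/m in yz est *.
have yE : y ^+ 2 = E by rewrite sqr_sqrtr// /E.
rewrite -yE.
apply: (@le_trans _ _ (2 * (z * (- (sigma ^+ 2 / 2) * z
       + (2 * r * (1 + M) + 2 * r ^+ 2 / Num.sqrt 3) * y
       + 2 * r ^+ 2 * M / Num.sqrt 3 * m)))).
  by apply: ler_wpM2l.
have sq3 : 0 < Num.sqrt 3 :> R by rewrite sqrtr_gt0; lra.
apply: dissipation_young => //.
- exact: pi_gt0.
- by rewrite addr_ge0// ?divr_ge0 ?mulr_ge0 ?addr_ge0 ?sqr_ge0 ?(ltW r0) ?(ltW sq3).
- exact: sqrtr_ge0.
- rewrite -/coercivity -[X in _ * X <= _](divfK (lt0r_neq0 eta0)).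
  rewrite [_ / eta * eta]mulrC mulrA; apply: ler_wpM2r => //.
  by rewrite divr_ge0 ?sqrtr_ge0 ?ltW.
- exact: sqrtr_ge0.
Qed.

End Decay.

Unset Implicit Arguments.

Theorem corollary2p4 (R : realType) (r M sigma sigma_s : R) :
  0 < r -> 0 <= M -> 0 < sigma ->
  0 < sigma_s -> sigma_s_equation r M sigma_s ->
  exists2 lambda : R, 0 < lambda &
  forall rho0 rho_r : R -> R,
    H_ep 3 rho0 -> P_e rho0 -> H_ep 2 rho_r -> P_e rho_r ->
    exists2 beta : R, 0 < beta &
    forall rho : R -> R -> R, solution r M sigma rho0 rho_r rho ->
    forall eta : R, 0 < eta ->
      Num.max (sigma_b2 r M + eta * c_b r M) (sigma_s ^+ 2) < sigma ^+ 2 ->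
      forall t : R, 0 <= t ->
        (L2norm (fun x => rho t x - 1)%R
         <= (beta * expR (- (lambda * t)))%:E
            + (eta^-1)%:E * L2norm rho_r)%E.
Proof.
move=> r0 M0 _ _ _.
pose k := coercivity r M sigma.
(* If kappa <= 0, no eta satisfies the assumption on sigma, and any rate will do. *)
exists (if 0 < k then k * pi / 2 else 1).
  by case: ifPn => // k0; rewrite divr_gt0// mulr_gt0// pi_gt0.
move=> rho0 rho_r H0 _ Hr Pr.
pose mu := @lebesgue_measure R.
pose E0 := \int[mu]_(x in `[-1, 1]) ((rho0 x - 1) ^+ 2).
have E00 : 0 <= E0 by apply: Rintegral_ge0 => x _; exact: sqr_ge0.
have beta0 : 0 < 2 * Num.sqrt (E0 + 1) by rewrite mulr_gt0// sqrtr_gt0; lra.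
exists (2 * Num.sqrt (E0 + 1)) => //.
move=> rho sol eta eta0; rewrite gt_max => /andP[hs _] t t0.
have [k0 _] := coercivity_gt0 r0 M0 eta0 hs.
rewrite -/k in k0; rewrite k0.
have [[rho' C1rho] rhoP pde cL2 rho00] := sol.
have Lrr : L2_loc rho_r by case: Hr => -[_ []].
have L0 : L2_loc rho0 by case: H0 => -[_ []].
have L1 : L2_loc (cst (-1) : R -> R).
  by apply: continuous_L2_loc; exact: cst_continuous.
have Lrho s : 0 <= s -> L2_loc (rho s).
  rewrite le_eqVlt => /predU1P[<-|s0]; first by rewrite rho00.
  by have [Cs _ _ _] := C1rho s s0; exact/continuous_L2_loc/C2_ep_continuous.
have Lpsi s : 0 <= s -> L2_loc (fun x => rho s x - 1).
  by move=> s0; exact: L2_locD (Lrho s s0) L1.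
rewrite (L2normE (Lpsi t t0)) (L2normE Lrr) -EFinM -EFinD lee_fin.
set m2 := \int[mu]_(x in `[-1, 1]) (rho_r x ^+ 2); set m := Num.sqrt m2.
pose E s := \int[mu]_(x in `[-1, 1]) ((rho s x - 1) ^+ 2).
rewrite -/(E t) [eta^-1 * m]mulrC.
have mu_ge0 : 0 <= m / eta by rewrite divr_ge0 ?sqrtr_ge0 ?ltW.
set b := 2 * Num.sqrt (E0 + 1).
have b2 : b ^+ 2 = 4 * (E0 + 1).
  by rewrite /b exprMn sqr_sqrtr ?addr_ge0//; ring.
move: t0; rewrite le_eqVlt => /predU1P[<-|t0].
  rewrite mulr0 oppr0 expR0 mulr1.
  apply: (@le_trans _ _ b); last by rewrite lerDl.
  rewrite -(ler_pXn2r (n := 2)) ?nnegrE ?sqrtr_ge0 ?(ltW beta0)//.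
  by rewrite sqr_sqrtr /E rho00 -/E0 ?b2//; lra.
have near1 : \forall s \near (0 : R), 0 <= s ->
    (L2norm (fun x => (rho s x - rho 0 x)%R) < 1%:E)%E.
  exact: (cL2 0 (lexx 0) _ (@nbhs_open_ereal_lt R 0 (fun=> 1) ltr01)).
have kp : 0 < k * pi by rewrite mulr_gt0// pi_gt0.
have ln2 : 0 < ln 2 / (k * pi) by rewrite divr_gt0// ln_gt0//; lra.
(* Gronwall starts at a positive time s, close enough to 0 for the loss
   e^(2 lambda s) to be at most 2 and for rho(s) to be within 1 of rho0. *)
have [s [s0 st s2 sL]] : exists s, [/\ 0 < s, s < t, expR (k * pi * s) <= 2 &
    (L2norm (fun x => (rho s x - rho 0 x)%R) < 1%:E)%E].
  near (0 : R)^'+ => s; exists s.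
  have s0 : 0 < s by near: s; exact: nbhs_right_gt.
  split => //.
  - have : s <= ln 2 / (k * pi) by near: s; apply: nbhs_right_ltW.
    rewrite ler_pdivlMr// [s * _]mulrC => sln.
    by rewrite -[leRHS]lnK ?posrE// ler_expR.
  - move: (ltW s0); near: s; apply: cvg_within; exact: near1.
have Es : E s <= 2 * (E0 + 1).
  have Ld : L2_loc (fun x => rho s x - rho 0 x).
    have -> : (fun x => rho s x - rho 0 x) = (fun x => rho s x + (-1) * rho 0 x).
      by apply/funext => x; rewrite mulN1r.
    by apply: L2_locD; [exact/Lrho/ltW|apply: L2_locZ; exact: Lrho].
  move: sL; rewrite (L2normE Ld) lte_fin; set D := Rintegral _ _ _ => D1.
  have D0 : 0 <= D by apply: Rintegral_ge0 => x _; exact: sqr_ge0.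
  have {}D1 : D <= 1.
    rewrite -(sqr_sqrtr D0) -[leRHS](expr1n _ 2) ler_pXn2r ?nnegrE ?sqrtr_ge0//.
    exact: ltW.
  have [_ ld] := Ld; have [_ l0] := Lpsi 0 (lexx 0).
  have [_ ls] := Lpsi s (ltW s0).
  have l2 := locally_integrableZ 2 (locally_integrableD l0 ld).
  (* (u + v)^2 <= 2 u^2 + 2 v^2 *)
  apply: (@le_trans _ _ (2 * (E0 + D))); last by lra.
  rewrite /E0 -rho00 -RintegralD_seg// -RintegralZ_seg; last first.
    exact: locally_integrableD.
  apply: le_Rintegral_seg => // x _.
  have := sqr_ge0 (rho 0 x - 1 - (rho s x - rho 0 x)); nra.
have := energy_gronwall C1rho
  (dissipation r0 M0 sol Hr Pr C1rho eta0 hs) s0 (ltW st).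
rewrite -/k -/(E s) -/(E t) -/m2 -/m => Et.
have Et2 : E t <= (m / eta) ^+ 2 + (b * expR (- (k * pi / 2 * t))) ^+ 2.
  apply: (le_trans Et); rewrite lerD2l.
  apply: (@le_trans _ _ (E s * expR (- (k * pi * (t - s))))).
    by apply: ler_wpM2r; [exact: expR_ge0|rewrite lerBlDr lerDl sqr_ge0].
  have -> : expR (- (k * pi * (t - s))) =
      expR (- (k * pi / 2 * t)) ^+ 2 * expR (k * pi * s).
    by rewrite -expRM_natl -expRD; congr expR; field.
  rewrite exprMn b2 mulrCA [leRHS]mulrC; apply: ler_wpM2l; first exact: sqr_ge0.
  have e0 : 0 <= E s by apply: Rintegral_ge0 => x _; exact: sqr_ge0.
  have := ler_pM e0 (expR_ge0 _) Es s2; lra.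
have x0 : 0 <= b * expR (- (k * pi / 2 * t)).
  by rewrite mulr_ge0 ?expR_ge0 ?(ltW beta0).
move: x0 Et2; set x := b * expR _ => x0 Et2.
rewrite -(ler_pXn2r (n := 2)) ?nnegrE ?sqrtr_ge0 ?addr_ge0//.
rewrite sqr_sqrtr; last by apply: Rintegral_ge0 => y _; exact: sqr_ge0.
by apply: (le_trans Et2); have := mulr_ge0 x0 mu_ge0; nra.
Unshelve. all: by end_near. Qed.
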